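(* Let $n\ge 4$. Any conformally flat space-like hypersurface $M$ ($\dim M=n$) in the Minkowski space $\mathbb{R}^{n+1}_1$ is locally a part of one of the following hypersurfaces: (i) a space-like hyperplane ($\alpha=\beta=0$); (ii) a space-like hypersphere ($\alpha\neq 0$, $\beta=0$); (iii) a space-like developable hypersurface ($\alpha=0$, $\beta\neq 0$); (iv) a space-like canal hypersurface ($\alpha\neq 0$, $\beta\neq 0$). Here $\alpha,\beta$ are the functions in the expression $h=\alpha\,g+\beta\,\eta\otimes\eta$ of the second fundamental form.
   Context: $\mathbb{R}^{n+1}_1$ is Minkowski space with scalar product of signature $(n,1)$; products of vectors are scalar products. A hypersurface of dimension $n$ is space-like if the induced metric $g$ is positive definite; it is conformally flat if $g$ is (locally) conformally flat. $h$ denotes the second fundamental form; for the hypersurfaces listed it has the form $h=\alpha\,g+\beta\,\eta\otimes\eta$ with functions $\alpha,\beta$ and a unit 1-form $\eta$. A developable hypersurface here corresponds to $h=\beta\,\eta\otimes\eta$ with $\beta\neq0$. A space-like hypersphere with center $z$ and radius $R>0$ is $\{Z:(Z-z)^2=-R^2\}$. A sphere of codimension two is an $(n-1)$-dimensional cross-section $S^{n-1}$ of a space-like hypersphere with a hyperplane. A canal space-like hypersurface is a space-like hypersurface $M=\{S^{n-1}(s)\}$, $s\in J\subset\mathbb R$, which is a one-parameter family of spheres of codimension two (spherical generators) such that the normals to $M$ at the points of any fixed generator pass through a fixed point.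
   Formalization: The form h=αg+βη⊗η is proved around every point, but ''locally a part of (i)-(iv)'' only near points around which each of α, β is identically zero or nowhere zero; these are shown to be dense. At other points the claim can fail. Parts of canal hypersurfaces have pieces of spheres as generators. *)

(* Defs.v *)
From HB Require Import structures.
From mathcomp Require Import all_boot all_order all_algebra.
From mathcomp Require Import all_classical all_reals all_analysis.

Set Implicit Arguments.
Unset Strict Implicit.
Unset Printing Implicit Defensive.

Import Order.TTheory GRing.Theory Num.Theory.
Import numFieldNormedType.Exports.

Local Open Scope classical_set_scope.
Local Open Scope ring_scope.

Fixpoint Ck_on (R : realType) (V W : normedModType R) (k : nat)
    (A : set V) (f : V -> W) : Prop :=
  match k with
  | 0 => forall x, A x -> {for x, continuous f}
  | k'.+1 => (forall x, A x -> differentiable f x) /\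
             (forall v : V, Ck_on k' A ('D_v f))
  end.

(* Only used on open sets [A]. *)
Definition smooth_on (R : realType) (V W : normedModType R)
    (A : set V) (f : V -> W) : Prop :=
  forall k : nat, Ck_on k A f.

Section Minkowski.
Variables (R : realType) (n : nat).

Implicit Types (M S : set 'rV[R]_n.+1) (U V : set 'rV[R]_n).
Implicit Types (phi nu : 'rV[R]_n -> 'rV[R]_n.+1).

Definition dot (x y : 'rV[R]_n) : R := \sum_(i < n) x 0 i * y 0 i.

(* The scalar product of signature (n, 1); the last coordinate is timelike. *)
Definition mink (X Y : 'rV[R]_n.+1) : R :=
  (\sum_(i < n) X 0 (widen_ord (leqnSn n) i) * Y 0 (widen_ord (leqnSn n) i))
  - X 0 ord_max * Y 0 ord_max.

Definition plane (a : 'rV[R]_n.+1) (b : R) : set 'rV[R]_n.+1 :=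
  [set Z | mink Z a = b].

Definition hyperquadric (z : 'rV[R]_n.+1) (r : R) : set 'rV[R]_n.+1 :=
  [set Z | mink (Z - z) (Z - z) = - r ^+ 2].

(* A hyperplane is space-like iff its Minkowski normal is timelike. *)
Definition spacelike_hyperplane S : Prop :=
  exists (a : 'rV[R]_n.+1) (b : R), mink a a < 0 /\ S = plane a b.

Definition spacelike_hypersphere S : Prop :=
  exists (z : 'rV[R]_n.+1) (r : R), 0 < r /\ S = hyperquadric z r.

(* A nonempty section of the hypersphere of center z and radius r by a
   hyperplane; it is (n - 1)-dimensional because the normals Z - z and a are
   linearly independent at each of its points. *)
Definition codim2_sphere (z : 'rV[R]_n.+1) (r : R) (a : 'rV[R]_n.+1) (b : R)
    S : Prop :=
  [/\ 0 < r, a != 0, S = hyperquadric z r `&` plane a b, S !=set0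
    & forall Z, S Z -> row_free (col_mx (Z - z) a)].

Definition codim2_plane (a : 'rV[R]_n.+1) (b : R) (c : 'rV[R]_n.+1) (d : R)
    S : Prop :=
  row_free (col_mx a c) /\ S = plane a b `&` plane c d.

(* phi is a homeomorphic immersion of the open set U onto a relatively open
   subset of M. *)
Definition local_parametrization M U phi : Prop :=
  [/\ open U /\ smooth_on U phi,
      forall x v, U x -> 'D_v phi x = 0 -> v = 0,
      phi @` U `<=` M,
      forall x y, U x -> U y -> phi x = phi y -> x = y
    & forall O : set 'rV[R]_n, open O -> O `<=` U ->
        exists W : set 'rV[R]_n.+1, open W /\ phi @` O = M `&` W].

Definition hypersurface M : Prop :=
  forall p, M p -> exists U phi, local_parametrization M U phi /\ (phi @` U) p.

Definition metric phi (x v w : 'rV[R]_n) : R := mink ('D_v phi x) ('D_w phi x).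

Definition spacelike M : Prop :=
  forall U phi, local_parametrization M U phi ->
    forall x v, U x -> v != 0 -> 0 < metric phi x v v.

(* Around each point there are coordinates in which the metric is a positive
   multiple of the Euclidean one.  The factor lambda is necessarily smooth. *)
Definition conformally_flat M : Prop :=
  forall p, M p -> exists U phi (lambda : 'rV[R]_n -> R),
    [/\ local_parametrization M U phi, (phi @` U) p
      & forall x, U x -> 0 < lambda x /\
          forall v w, metric phi x v w = lambda x * dot v w].

Definition unit_normal U phi nu : Prop :=
  smooth_on U nu /\
  forall x, U x -> mink (nu x) (nu x) = -1 /\
                   forall v, mink (nu x) ('D_v phi x) = 0.

(* The coefficient h(v, w) in the Gauss formula
   D_v (D_w phi) = tangential part + h(v, w) nu; as (nu, nu) = -1, it is minus
   the scalar product with nu. *)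
Definition second_form phi nu (x v w : 'rV[R]_n) : R :=
  - mink ('D_v ('D_w phi) x) (nu x).

(* A 1-form is given by its coefficient vector e, v |-> dot e v.  It has unit
   length when it is dual, with respect to the metric, to a unit vector. *)
Definition unit_covector phi (x e : 'rV[R]_n) : Prop :=
  exists xi, metric phi x xi xi = 1 /\ forall v, dot e v = metric phi x xi v.

Definition second_form_decomposition U phi nu (alpha beta : 'rV[R]_n -> R)
    (eta : 'rV[R]_n -> 'rV[R]_n) : Prop :=
  forall x, U x ->
    unit_covector phi x (eta x) /\
    forall v w, second_form phi nu x v w =
      alpha x * metric phi x v w + beta x * (dot (eta x) v * dot (eta x) w).

(* The level sets of the submersion sigma are the generators. *)
Definition one_parameter_foliation V (J : set R) (sigma : 'rV[R]_n -> R)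
    : Prop :=
  [/\ open J /\ is_interval J, smooth_on V sigma, sigma @` V = J
    & forall x, V x -> exists v, 'D_v sigma x != 0].

(* A one-parameter family of pieces of (n - 1)-planes, along each of which the
   normal (equivalently the tangent hyperplane) is constant. *)
Definition developable V phi nu : Prop :=
  exists (J : set R) (sigma : 'rV[R]_n -> R) (a c : R -> 'rV[R]_n.+1)
      (b d : R -> R) (P : R -> set 'rV[R]_n.+1),
    [/\ one_parameter_foliation V J sigma,
        [/\ smooth_on J a, smooth_on J b, smooth_on J c & smooth_on J d],
        forall s, J s -> codim2_plane (a s) (b s) (c s) (d s) (P s),
        forall x, V x -> P (sigma x) (phi x)
      & forall x y, V x -> V y -> sigma x = sigma y -> nu x = nu y].

(* A one-parameter family of pieces of spheres of codimension two such that the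
   normal lines at the points of the generator s pass through the point c s. *)
Definition canal V phi nu : Prop :=
  exists (J : set R) (sigma : 'rV[R]_n -> R) (z a : R -> 'rV[R]_n.+1)
      (r b : R -> R) (S : R -> set 'rV[R]_n.+1) (c : R -> 'rV[R]_n.+1),
    [/\ one_parameter_foliation V J sigma,
        [/\ smooth_on J z, smooth_on J r, smooth_on J a & smooth_on J b],
        forall s, J s -> codim2_sphere (z s) (r s) (a s) (b s) (S s),
        forall x, V x -> S (sigma x) (phi x)
      & forall x, V x -> exists t : R, c (sigma x) = phi x + t *: nu x].

Definition zero_on V (f : 'rV[R]_n -> R) : Prop := forall x, V x -> f x = 0.

Definition nonzero_on V (f : 'rV[R]_n -> R) : Prop := forall x, V x -> f x != 0.

(* The points around which each of alpha, beta either vanishes identically or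
   has no zero, i.e. at which exactly one of the four types can occur. *)
Definition generic U (alpha beta : 'rV[R]_n -> R) : set 'rV[R]_n :=
  [set x | exists V, [/\ open V, V x, V `<=` U,
     zero_on V alpha \/ nonzero_on V alpha
   & zero_on V beta \/ nonzero_on V beta]].

Definition one_of_four_types V phi nu (alpha beta : 'rV[R]_n -> R) : Prop :=
  [\/ [/\ exists2 S, spacelike_hyperplane S & phi @` V `<=` S,
          zero_on V alpha & zero_on V beta],
      [/\ exists2 S, spacelike_hypersphere S & phi @` V `<=` S,
          nonzero_on V alpha & zero_on V beta],
      [/\ developable V phi nu, zero_on V alpha & nonzero_on V beta]
    | [/\ canal V phi nu, nonzero_on V alpha & nonzero_on V beta]].

End Minkowski.

(* Main.v *)
Require Import Defs.
From HB Require Import structures.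
From mathcomp Require Import all_boot all_order all_algebra.
From mathcomp Require Import all_classical all_reals all_analysis.
From mathcomp Require Import ring lra.

Set Implicit Arguments.
Unset Strict Implicit.
Unset Printing Implicit Defensive.

Import Order.TTheory GRing.Theory Num.Theory.
Import numFieldNormedType.Exports.

Local Open Scope classical_set_scope.
Local Open Scope ring_scope.

(** Conformal coordinates give an immersion phi of an open set U whose induced
    metric is lam times the Euclidean scalar product; subtracting from a fixed
    timelike vector its tangential part yields a smooth unit normal nu.  The
    whole argument is then carried out on the pair (phi, nu).

    Let a, b, c, d be mutually orthogonal constant vectors.  By Koszul's formula
    [koszul] the tangential part of D_a D_b phi is a combination of D_a phi and
    D_b phi, so (D_a D_b phi, D_d phi) = 0 on U.  Differentiating this along c
    and using the symmetry of third derivatives in b and c gives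
      (D_a D_b phi, D_c D_d phi) = (D_a D_c phi, D_b D_d phi),
    and since the tangential parts contribute nothing,
      h(a, b) h(c, d) = h(a, c) h(b, d)                              [gauss].
    This is what the Gauss equation and the vanishing of the Weyl tensor amount
    to; the curvature tensor itself never appears.  For n >= 4 a symmetric form
    with this property is alpha g + beta (eta tensor eta): [cartan_form].

    The functions alpha and beta are recovered from traces of powers of the
    trace-free part of h.  So they are smooth on open sets where beta has no zero
    or vanishes identically, and the points around which the type does not change
    are dense: [generic_dense].

    The Codazzi equation gives d alpha = 0 on the kernel of eta: [codazzi].
    Hence if beta = 0, either nu is constant, or alpha and phi - nu / alpha are,
    and M lies in a hyperplane or in a hypersphere.  If beta has no zero, let F
    be nu when alpha = 0 and the center phi - nu / alpha otherwise.  The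
    differential of F has rank one and the kernel of eta as kernel.  So F is
    locally a curve a composed with a submersion sigma to an interval, and so is
    every function whose differential vanishes on the kernel of eta
    ([level_box], [foliation]).  M is the envelope of the hyperplanes with
    normal a(s), respectively of the hyperspheres with center a(s); the equation
    of the envelope and its derivative in s cut out the generator s, a plane or
    a sphere of codimension two. *)

(** * Functions of class C^k on an open set *)

Section Calculus.
Context {R : realType}.
Implicit Types V W : normedModType R.

Lemma near_eq_differentiable V W (f g : V -> W) (x : V) :
  (\near x, f x = g x) -> differentiable f x -> differentiable g x.
Proof.
move=> fg df.
have H : g \o shift x = cst (g x) + 'd f x +o_ 0 id.
  apply/eqaddoP => e e0.
  have /eqaddoP/(_ e e0) := diff_locally df.
  apply: filterS2; last first.
    have : \forall y \near (0 : V), f (y + x) = g (y + x).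
      by move: fg; rewrite (near_shift 0) subr0.
    exact.
  move=> y /= fgy; rewrite !fctE /= fgy; have -> // : f x = g x.
  exact: (nbhs_singleton fg).
have cf := diff_continuous df.
have E := diff_unique cf H.
by apply/diff_locallyP; rewrite E; split.
Qed.

Lemma scale_fun_diff V W (a : V -> R) (f : V -> W) x :
  differentiable a x -> differentiable f x ->
  differentiable (fun y => a y *: f y) x /\
  forall v, 'D_v (fun y => a y *: f y) x = 'D_v a x *: f x + a x *: 'D_v f x.
Proof.
move=> da df.
have bil : bilinear_for (GRing.Scale.Law.clone _ _ *:%R _)
    (GRing.Scale.Law.clone _ _ *:%R _) (fun (b : R) (w : W) => b *: w).
  split=> [u'|u] b y z /=; first by rewrite scalerDl scalerA.
  by rewrite scalerDr !scalerA mulrC.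
pose sM := bilinear_isBilinear.Build R R W W _ _
  (fun (b : R) (w : W) => b *: w) bil.
pose s : {bilinear R -> W -> W} :=
  HB.pack (fun (b : R) (w : W) => b *: w) sM.
have sc : continuous (fun p : R * W => s p.1 p.2) by exact: scale_continuous.
have dsp p : differentiable (fun p : R * W => s p.1 p.2) p.
  exact: differentiable_bilin.
have dp := differentiable_pair da df.
have E : (fun y => a y *: f y) =
  (fun p : R * W => s p.1 p.2) \o (fun y => (a y, f y)) by [].
have D : differentiable (fun y => a y *: f y) x.
  by rewrite E; apply: differentiable_comp => //.
have ds p q : 'd (fun p : R * W => s p.1 p.2) p q = s p.1 q.2 + s q.1 p.2.
  by rewrite diff_bilin.
split=> // v; rewrite deriveE // E diff_comp //.
rewrite -[LHS]/('d (fun p : R * W => s p.1 p.2) (a x, f x)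
  ('d (fun y => (a y, f y)) x v)) ds diff_pair //=.
by rewrite !deriveE // addrC.
Qed.

Lemma lin_fun_diff V W (W' : normedModType R) (L : {linear W -> W'})
    (f : V -> W) x : continuous L -> differentiable f x ->
  differentiable (L \o f) x /\ forall v, 'D_v (L \o f) x = L ('D_v f x).
Proof.
move=> cL df.
have dL : differentiable L (f x) by exact: linear_differentiable.
have D : differentiable (L \o f) x by exact: differentiable_comp.
by split=> // v; rewrite !deriveE // diff_comp //= diff_lin.
Qed.

Lemma comp_real_diff V W (g : R -> W) (f : V -> R) x :
  differentiable f x -> differentiable g (f x) ->
  differentiable (g \o f) x /\
  forall v, 'D_v (g \o f) x = 'D_v f x *: 'D_1 g (f x).
Proof.
move=> df dg; have D : differentiable (g \o f) x by exact: differentiable_comp.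
split=> // v; rewrite !deriveE // diff_comp //=.
by rewrite -[X in 'd g _ X]mulr1 -linearZ.
Qed.

Lemma line_diff V W (g : V -> W) (x u : V) (t : R) :
  differentiable g (x + t *: u) ->
  differentiable (fun s : R => g (x + s *: u)) t /\
  forall v : R,
    'D_v (fun s : R => g (x + s *: u)) t = v *: 'D_u g (x + t *: u).
Proof.
move=> dg.
have dl : is_diff t (fun s : R => x + s *: u) (fun v => v *: u).
  have -> : (fun s : R => x + s *: u) = cst x + *:%R ^~ u by [].
  by apply: is_diff_eq; rewrite funeqE => y /=; rewrite !fctE add0r.
have dl' : differentiable (fun s : R => x + s *: u) t by exact: ex_diff.
have D : differentiable (g \o (fun s : R => x + s *: u)) t.
  exact: differentiable_comp.
split=> // v.
rewrite (_ : (fun s : R => g (x + s *: u)) = g \o (fun s : R => x + s *: u)) //.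
by rewrite !deriveE // diff_comp //= diff_val linearZ.
Qed.

Lemma Ck_on_ext V W k (A : set V) (f g : V -> W) : open A ->
  (forall x, A x -> f x = g x) -> Ck_on k A f -> Ck_on k A g.
Proof.
move=> oA; elim: k f g => [|k IH] f g fg /=.
  move=> cf x Ax; have nfg : \near x, f x = g x.
    by apply: filterS fg _; exact: open_nbhs_nbhs.
  change (g @ x --> g x); rewrite -(fg _ Ax).
  exact: cvg_trans (near_eq_cvg nfg) (cf _ Ax).
have nfg x : A x -> \near x, f x = g x.
  by move=> Ax; apply: filterS fg _; exact: open_nbhs_nbhs.
move=> [df Df]; split=> [x Ax|v].
  exact: near_eq_differentiable (nfg _ Ax) (df _ Ax).
apply: IH (Df v) => x Ax; exact: near_eq_derive (nfg _ Ax).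
Qed.

Lemma Ck_onW V W k (A : set V) (f : V -> W) : Ck_on k.+1 A f -> Ck_on k A f.
Proof.
elim: k f => [|k IH] f [df Df]; last by split=> // v; apply: IH.
by move=> x Ax; exact/differentiable_continuous/df.
Qed.

Lemma Ck_on_sub V W k (A B : set V) (f : V -> W) :
  B `<=` A -> Ck_on k A f -> Ck_on k B f.
Proof.
move=> BA; elim: k f => [|k IH] f /=; first by move=> cf x /BA; exact: cf.
by move=> [df Df]; split=> [x /BA|v]; [exact: df|exact: IH].
Qed.

Lemma Ck_on_cst V W k (A : set V) (w : W) : Ck_on k A (fun=> w).
Proof.
elim: k w => [|k IH] w /=; first by move=> x _; exact: cst_continuous.
split=> [x _|v]; first exact: differentiable_cst.
by have -> : 'D_v (fun=> w) = (fun _ : V => 0) :> (V -> W);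
  [rewrite funeqE => x; exact: derive_cst|exact: IH].
Qed.

Lemma Ck_onD V W k (A : set V) (f g : V -> W) : open A ->
  Ck_on k A f -> Ck_on k A g -> Ck_on k A (fun x => f x + g x).
Proof.
move=> oA; elim: k f g => [|k IH] f g /=.
  by move=> cf cg x Ax; apply: continuousD; [exact: cf|exact: cg].
move=> [df Df] [dg Dg]; split=> [x Ax|v].
  by apply: differentiableD; [exact: df|exact: dg].
apply: (Ck_on_ext (f := fun x => 'D_v f x + 'D_v g x)) => //; last exact: IH.
move=> x Ax; rewrite (_ : (fun y => f y + g y) = f + g) //.
by rewrite deriveD //; apply: diff_derivable; [exact: df|exact: dg].
Qed.

Lemma Ck_on_scale V W k (A : set V) (a : V -> R) (f : V -> W) : open A ->
  Ck_on k A a -> Ck_on k A f -> Ck_on k A (fun x => a x *: f x).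
Proof.
move=> oA; elim: k a f => [|k IH] a f.
  by move=> ca cf x Ax; apply: cvgZ; [exact: ca|exact: cf].
move=> Ca Cf; have [da Da] := Ca; have [df Df] := Cf; split=> [x Ax|v].
  by have [] := scale_fun_diff (da _ Ax) (df _ Ax).
apply: (Ck_on_ext (f := fun x => 'D_v a x *: f x + a x *: 'D_v f x)) => //.
  by move=> x Ax; have [_ ->] := scale_fun_diff (da _ Ax) (df _ Ax).
by apply: Ck_onD => //; apply: IH;
  [exact: Da|exact: Ck_onW Cf|exact: Ck_onW Ca|exact: Df].
Qed.

Lemma Ck_on_lin V W (W' : normedModType R) k (A : set V)
    (L : {linear W -> W'}) (f : V -> W) :
  open A -> continuous L -> Ck_on k A f -> Ck_on k A (L \o f).
Proof.
move=> oA cL; elim: k f => [|k IH] f.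
  by move=> cf x Ax; apply: continuous_comp; [exact: cf|exact: cL].
move=> [df Df]; split=> [x Ax|v].
  by have [] := lin_fun_diff cL (df _ Ax).
apply: (Ck_on_ext (f := L \o 'D_v f)) => //; last exact/IH/Df.
by move=> x Ax; have [_ ->] := lin_fun_diff cL (df _ Ax).
Qed.

Lemma Ck_on_comp V W k (A : set V) (B : set R) (g : R -> W) (f : V -> R) :
  open A -> (forall x, A x -> B (f x)) ->
  Ck_on k B g -> Ck_on k A f -> Ck_on k A (g \o f).
Proof.
move=> oA AB; elim: k g f AB => [|k IH] g f AB.
  move=> cg cf x Ax; apply: continuous_comp; first exact: cf.
  exact/cg/AB.
move=> Cg Cf; have [dg Dg] := Cg; have [df Df] := Cf; split=> [x Ax|v].
  by have [] := comp_real_diff (df _ Ax) (dg _ (AB _ Ax)).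
apply: (Ck_on_ext (f := fun x => 'D_v f x *: ('D_1 g \o f) x)) => //.
  by move=> x Ax; have [_ ->] := comp_real_diff (df _ Ax) (dg _ (AB _ Ax)).
by apply: Ck_on_scale; [|exact: Df|apply: IH; [|exact: Dg|exact: Ck_onW Cf]].
Qed.

Lemma Ck_on_line V W k (A : set V) (B : set R) (g : V -> W) (x u : V) :
  open B -> (forall t, B t -> A (x + t *: u)) ->
  Ck_on k A g -> Ck_on k B (fun t => g (x + t *: u)).
Proof.
move=> oB BA; elim: k g => [|k IH] g.
  move=> cg t Bt; apply: (@continuous_comp _ _ _ (fun s : R => x + s *: u) g).
    apply: continuousD; first exact: cst_continuous.
    exact: scalel_continuous.
  exact/cg/BA.
move=> [dg Dg]; split=> [t Bt|v].
  by have [] := line_diff (dg _ (BA _ Bt)).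
apply: (Ck_on_ext (f := fun t : R => v *: 'D_u g (x + t *: u))) => //.
  by move=> t Bt; have [_ ->] := line_diff (dg _ (BA _ Bt)).
by apply: Ck_on_scale => //; [exact: Ck_on_cst|apply: (IH ('D_u g)); exact: Dg].
Qed.

End Calculus.

(** * Smooth functions *)

Section Smooth.
Context {R : realType}.
Implicit Types V W : normedModType R.

Lemma smooth_on_ext V W (A : set V) (f g : V -> W) : open A ->
  (forall x, A x -> f x = g x) -> smooth_on A f -> smooth_on A g.
Proof. by move=> oA fg sf k; exact: Ck_on_ext (sf k). Qed.

Lemma smooth_on_sub V W (A B : set V) (f : V -> W) :
  B `<=` A -> smooth_on A f -> smooth_on B f.
Proof. by move=> BA sf k; exact: Ck_on_sub (sf k). Qed.

Lemma smooth_differentiable V W (A : set V) (f : V -> W) x :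
  smooth_on A f -> A x -> differentiable f x.
Proof. by move=> /(_ 1) [df _]; exact: df. Qed.

Lemma smooth_continuous V W (A : set V) (f : V -> W) x :
  smooth_on A f -> A x -> {for x, continuous f}.
Proof. by move=> /(_ 0); exact. Qed.

Lemma smooth_derive V W (A : set V) (f : V -> W) v :
  smooth_on A f -> smooth_on A ('D_v f).
Proof. by move=> sf k; have [_] := sf k.+1; exact. Qed.

Lemma smooth_on_cst V W (A : set V) (w : W) : smooth_on A (fun=> w).
Proof. by move=> k; exact: Ck_on_cst. Qed.

Lemma smooth_onD V W (A : set V) (f g : V -> W) : open A ->
  smooth_on A f -> smooth_on A g -> smooth_on A (fun x => f x + g x).
Proof. by move=> oA sf sg k; exact: Ck_onD. Qed.

Lemma smooth_on_scale V W (A : set V) (a : V -> R) (f : V -> W) : open A ->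
  smooth_on A a -> smooth_on A f -> smooth_on A (fun x => a x *: f x).
Proof. by move=> oA sf sg k; exact: Ck_on_scale. Qed.

Lemma smooth_onM V (A : set V) (f g : V -> R) : open A ->
  smooth_on A f -> smooth_on A g -> smooth_on A (fun x => f x * g x).
Proof. exact: smooth_on_scale. Qed.

Lemma smooth_onN V W (A : set V) (f : V -> W) : open A ->
  smooth_on A f -> smooth_on A (fun x => - f x).
Proof.
move=> oA sf; apply: (smooth_on_ext (f := fun x => (-1) *: f x)) => //.
  by move=> x _; rewrite scaleN1r.
by apply: smooth_on_scale => //; exact: smooth_on_cst.
Qed.

Lemma smooth_onB V W (A : set V) (f g : V -> W) : open A ->
  smooth_on A f -> smooth_on A g -> smooth_on A (fun x => f x - g x).
Proof. by move=> oA sf sg; apply: smooth_onD => //; exact: smooth_onN. Qed.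

Lemma smooth_on_sum V W (A : set V) (I : Type) (r : seq I) (f : I -> V -> W) :
  open A -> (forall i, smooth_on A (f i)) ->
  smooth_on A (fun x => \sum_(i <- r) f i x).
Proof.
move=> oA sf; elim: r => [|i r IH].
  by apply: (smooth_on_ext (f := fun=> 0)) => [//|x _|];
    [rewrite big_nil|exact: smooth_on_cst].
apply: (smooth_on_ext (f := fun x => f i x + \sum_(j <- r) f j x)) => //.
  by move=> x _; rewrite big_cons.
exact: smooth_onD.
Qed.

Lemma smooth_on_lin V W (W' : normedModType R) (A : set V)
    (L : {linear W -> W'}) (f : V -> W) :
  open A -> continuous L -> smooth_on A f -> smooth_on A (L \o f).
Proof. by move=> oA cL sf k; exact: Ck_on_lin. Qed.

Lemma smooth_on_comp V W (A : set V) (B : set R) (g : R -> W) (f : V -> R) :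
  open A -> (forall x, A x -> B (f x)) ->
  smooth_on B g -> smooth_on A f -> smooth_on A (g \o f).
Proof. by move=> oA AB sg sf k; exact: Ck_on_comp (sg k) (sf k). Qed.

Lemma smooth_on_line V W (A : set V) (B : set R) (g : V -> W) (x u : V) :
  open B -> (forall t, B t -> A (x + t *: u)) ->
  smooth_on A g -> smooth_on B (fun t => g (x + t *: u)).
Proof. by move=> oB BA sg k; exact: Ck_on_line (sg k). Qed.

Lemma derive_real W (f : R -> W) (t v : R) : differentiable f t ->
  'D_v f t = v *: 'D_1 f t.
Proof.
move=> df; rewrite !deriveE //.
by rewrite -[X in 'd f t X]mulr1 -[v * 1]/(v *: (1 : R)) linearZ.
Qed.

(** Bootstrapping: if f is C^k, so is its derivative g, and then f is C^(k+1).
    The inverse, the square root, and later the inverse of a monotone function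
    are smooth for this reason. *)
Lemma smooth_on_ode W (B : set R) (f g : R -> W) : open B ->
  (forall t, B t -> differentiable f t) ->
  (forall t, B t -> 'D_1 f t = g t) ->
  (forall k, Ck_on k B f -> Ck_on k B g) -> smooth_on B f.
Proof.
move=> oB df Df Cg; elim=> [|k IH].
  by move=> t Bt; exact/differentiable_continuous/df.
split=> // v; apply: (Ck_on_ext (f := fun t => v *: g t)) => //.
  by move=> t Bt; rewrite derive_real ?Df //; exact: df.
by apply: Ck_on_scale => //; [exact: Ck_on_cst|exact: Cg].
Qed.

Lemma smooth_inv : smooth_on [set t : R | t != 0] (fun t => t^-1).
Proof.
have o0 : open [set t : R | t != 0].
  by move=> t /= t0; exact: open_neq.
apply: (@smooth_on_ode R _ _ (fun t => - (t^-1 * t^-1))) => //.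
- by move=> t t0; exact: differentiable_Rinv.
- move=> t /= t0; rewrite (@deriveV _ _ (id : R -> R)) // derive_id.
  by rewrite -exprVn expr2 scaleNr /GRing.scale /= mulr1.
- move=> k Ck; apply: (Ck_on_ext (f := fun t : R => (-1) *: (t^-1 *: t^-1))).
  + exact: o0.
  + by move=> t _; rewrite scaleN1r.
  by apply: Ck_on_scale => //; [exact: Ck_on_cst|exact: Ck_on_scale].
Qed.

Lemma smooth_sqrt : smooth_on [set t : R | 0 < t] (@Num.sqrt R).
Proof.
have o0 : open [set t : R | 0 < t] by exact: open_gt.
apply: (@smooth_on_ode R _ _ (fun t => 2^-1 * (Num.sqrt t)^-1)) => //.
- move=> t t0; apply/derivable1_diffP.
  by have := is_derive1_sqrt t0.
- by move=> t t0; rewrite derive_sqrt // invfM.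
- move=> k Ck; apply: Ck_on_scale => //; first exact: Ck_on_cst.
  apply: (Ck_on_comp (B := [set t : R | t != 0])) Ck => //; last exact: smooth_inv.
  by move=> x /= x0; rewrite gt_eqF // sqrtr_gt0.
Qed.

Lemma smooth_onV V (A : set V) (f : V -> R) : open A ->
  (forall x, A x -> f x != 0) -> smooth_on A f ->
  smooth_on A (fun x => (f x)^-1).
Proof. by move=> oA f0 sf; exact: smooth_on_comp (smooth_inv) sf. Qed.

Lemma smooth_on_sqrt V (A : set V) (f : V -> R) : open A ->
  (forall x, A x -> 0 < f x) -> smooth_on A f ->
  smooth_on A (fun x => Num.sqrt (f x)).
Proof. by move=> oA f0 sf; exact: smooth_on_comp (smooth_sqrt) sf. Qed.

End Smooth.

(** * Vector-valued functions, the mean value theorem and Schwarz's theorem *)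

Section Vectors.
Context {R : realType}.
Implicit Types V W : normedModType R.

Lemma sum_fun_diff V W (I : Type) (r : seq I) (f : I -> V -> W) x :
  (forall i, differentiable (f i) x) ->
  differentiable (fun y => \sum_(i <- r) f i y) x /\
  forall v, 'D_v (fun y => \sum_(i <- r) f i y) x = \sum_(i <- r) 'D_v (f i) x.
Proof.
move=> df; elim: r => [|i r [IHd IHv]].
  have -> : (fun y => \sum_(i <- [::]) f i y) = cst 0.
    by rewrite funeqE => y; rewrite big_nil.
  by split=> [|v]; [exact: differentiable_cst|rewrite big_nil derive_cst].
have -> : (fun y => \sum_(j <- i :: r) f j y) =
    f i + (fun y => \sum_(j <- r) f j y).
  by rewrite funeqE => y; rewrite big_cons.
split=> [|v]; first exact: differentiableD.
by rewrite deriveD ?IHv ?big_cons //; exact: diff_derivable.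
Qed.

Lemma mul_fun_diff V (f g : V -> R) x :
  differentiable f x -> differentiable g x ->
  differentiable (fun y => f y * g y) x /\
  forall v, 'D_v (fun y => f y * g y) x = 'D_v f x * g x + f x * 'D_v g x.
Proof. by move=> df dg; have := scale_fun_diff df dg. Qed.

Definition coordf m (i : 'I_m) (X : 'rV[R]_m) : R := X 0 i.

Lemma coordf_is_linear m (i : 'I_m) : linear (coordf i).
Proof. by move=> a X Y; rewrite /coordf !mxE. Qed.

HB.instance Definition _ m (i : 'I_m) :=
  GRing.isLinear.Build R 'rV[R]_m R *:%R (coordf i) (coordf_is_linear i).

Lemma coordf_continuous m (i : 'I_m) : continuous (coordf i).
Proof. exact: coord_continuous. Qed.

Lemma coord_diff V m (f : V -> 'rV[R]_m) i x : differentiable f x ->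
  differentiable (fun y => f y 0 i) x /\
  forall v, 'D_v (fun y => f y 0 i) x = 'D_v f x 0 i.
Proof. by move=> df; have := lin_fun_diff (@coordf_continuous _ i) df. Qed.

Lemma smooth_coord V (A : set V) m (f : V -> 'rV[R]_m) i :
  open A -> smooth_on A f -> smooth_on A (fun y => f y 0 i).
Proof. by move=> oA sf; exact: smooth_on_lin (@coordf_continuous _ i) sf. Qed.

Lemma smooth_row V (A : set V) m (f : V -> 'I_m -> R) :
  open A -> (forall i, smooth_on A (f ^~ i)) ->
  smooth_on A (fun x => \row_i f x i).
Proof.
move=> oA sf.
apply: (smooth_on_ext (f := fun x => \sum_i f x i *: delta_mx 0 i)) => //.
  by move=> x _; rewrite [RHS]row_sum_delta; apply: eq_bigr => i _; rewrite mxE.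
apply: smooth_on_sum => // i; apply: smooth_on_scale => //.
exact: smooth_on_cst.
Qed.

(** The differentiability is required at the end points too, so that continuity
    up to the boundary comes for free. *)
Lemma line_MVT V (f : V -> R) (x u : V) (a b : R) : a <= b ->
  (forall t, a <= t <= b -> differentiable f (x + t *: u)) ->
  exists2 c, a <= c <= b &
    f (x + b *: u) - f (x + a *: u) = 'D_u f (x + c *: u) * (b - a).
Proof.
move=> ab df; pose g (t : R) := f (x + t *: u).
have dg t : a <= t <= b -> is_derive t 1 g ('D_u f (x + t *: u)).
  move=> /df dft; have [d D] := line_diff dft.
  by split; [exact: diff_derivable|rewrite D scale1r].
have [t tab||c cab E] := @MVT_segment _ g (fun t => 'D_u f (x + t *: u)) a b ab.
- apply: dg; rewrite in_itv /= in tab.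
  by case/andP: tab => /ltW -> /ltW ->.
- apply: derivable_within_continuous => y yab; apply: ex_derive.
  by apply: dg; rewrite in_itv /= in yab.
by exists c => //; rewrite in_itv /= in cab.
Qed.

Lemma ball_segment V (x y : V) (r : R) t : ball x r y -> 0 <= t <= 1 ->
  ball x r (x + t *: (y - x)).
Proof.
rewrite -!ball_normE /= => xy /andP[t0 t1].
rewrite opprD addNKr normrN normrZ distrC ger0_norm //.
by apply: le_lt_trans xy; rewrite ler_piMl.
Qed.

Lemma ball_const V (f : V -> R) (x y : V) (r : R) :
  (forall z, ball x r z -> differentiable f z) ->
  (forall z v, ball x r z -> 'D_v f z = 0) -> ball x r y -> f y = f x.
Proof.
move=> df Df xy.
have [t t01|c c01] := @line_MVT V f x (y - x) 0 1 ler01.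
  by apply/df/ball_segment.
rewrite Df ?mul0r; last exact: ball_segment.
by rewrite scale1r scale0r addr0 subrKC => /eqP; rewrite subr_eq0 => /eqP.
Qed.

Lemma ball_const_row V m (f : V -> 'rV[R]_m) (x y : V) (r : R) :
  (forall z, ball x r z -> differentiable f z) ->
  (forall z v, ball x r z -> 'D_v f z = 0) -> ball x r y -> f y = f x.
Proof.
move=> df Df xy; apply/rowP => i.
apply: (@ball_const _ (fun z => f z 0 i) x y r) => // z.
  by move=> /df/(coord_diff i)[].
by move=> v xz; have [_ ->] := coord_diff i (df _ xz); rewrite Df // mxE.
Qed.

(** The mean value theorem along w, then along v.  Exchanging v and w does not
    change the left-hand side, whence the symmetry of second derivatives. *)
Lemma second_difference V (A : set V) (f : V -> R) (x v w : V) (s : R) :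
  0 <= s -> smooth_on A f ->
  (forall t t', 0 <= t <= s -> 0 <= t' <= s -> A (x + t *: v + t' *: w)) ->
  exists t t', [/\ 0 <= t <= s, 0 <= t' <= s &
    f (x + s *: v + s *: w) - f (x + s *: v) - f (x + s *: w) + f x =
    s ^+ 2 * 'D_v ('D_w f) (x + t *: v + t' *: w)].
Proof.
move=> s0 sf Ax.
have s0s : 0 <= s <= s by rewrite s0 lexx.
have d1 t : 0 <= t <= s -> differentiable f (x + s *: v + t *: w).
  by move=> ts; apply: smooth_differentiable sf _; exact: Ax.
have d0 t : 0 <= t <= s -> differentiable f (x + t *: w).
  move=> ts; apply: smooth_differentiable sf _.
  by rewrite -[x]addr0 -(scale0r v); apply: Ax => //; rewrite lexx.
pose g t := f (x + s *: v + t *: w) - f (x + t *: w).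
have dg t : 0 <= t <= s ->
    is_derive t 1 g ('D_w f (x + s *: v + t *: w) - 'D_w f (x + t *: w)).
  move=> ts; have [e1 D1] := line_diff (d1 _ ts).
  have [e0 D0] := line_diff (d0 _ ts).
  rewrite -[X in is_derive _ _ _ (X - _)]scale1r -D1.
  rewrite -[X in is_derive _ _ _ (_ - X)]scale1r -D0.
  by apply: is_deriveB; apply: derivableP; exact: diff_derivable.
have [t ts||c cs] := @MVT_segment _ g
    (fun t => 'D_w f (x + s *: v + t *: w) - 'D_w f (x + t *: w)) 0 s s0.
- by apply: dg; rewrite in_itv /= in ts; case/andP: ts => /ltW -> /ltW ->.
- apply: derivable_within_continuous => y ys; apply: ex_derive.
  by apply: dg; rewrite in_itv /= in ys.
rewrite in_itv /= in cs.
have [t ts|b bs] := @line_MVT V ('D_w f) (x + c *: w) v 0 s s0.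
  apply: smooth_differentiable (smooth_derive w sf) _.
  by rewrite addrAC; exact: Ax.
rewrite scale0r addr0 subr0 addrAC [x + _ *: w + _]addrAC => E' E.
exists b, c; split=> //; rewrite E' in E.
rewrite (_ : s ^+ 2 * _ = 'D_v ('D_w f) (x + b *: v + c *: w) * s * s).
  by rewrite -E /g !scale0r !addr0; ring.
by ring.
Qed.

Lemma Schwarz_real V (A : set V) (f : V -> R) (x v w : V) : open A -> A x ->
  smooth_on A f -> 'D_v ('D_w f) x = 'D_w ('D_v f) x.
Proof.
move=> oA Ax sf; apply/eqP; rewrite -subr_eq0 -normr_le0.
apply/ler_addgt0Pl => e e0; rewrite addr0.
have near_e (v' w' : V) : \forall y \near x,
    `|'D_v' ('D_w' f) x - 'D_v' ('D_w' f) y| < e / 2.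
  have c := smooth_continuous (smooth_derive v' (smooth_derive w' sf)) Ax.
  by move/cvgrPdist_lt: c => /(_ (e / 2)); apply; rewrite divr_gt0.
have nA : \forall y \near x, A y by exact: open_nbhs_nbhs.
have : \forall y \near x, [/\ A y,
    `|'D_v ('D_w f) x - 'D_v ('D_w f) y| < e / 2 &
    `|'D_w ('D_v f) x - 'D_w ('D_v f) y| < e / 2].
  by apply: filterS3 nA (near_e v w) (near_e w v) => y Ay H1 H2; split.
move=> /nbhs_ballP[d /= d0 dP].
pose k := `|v| + `|w| + 1; have k0 : 0 < k.
  by rewrite ltr_wpDl ?addr_ge0.
(* The parallelogram of sides s v and s w is contained in the ball. *)
pose s := d / k / 2.
have s0 : 0 < s by rewrite !divr_gt0.
have inb t t' : 0 <= t <= s -> 0 <= t' <= s -> ball x d (x + t *: v + t' *: w).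
  move=> /andP[t0 ts] /andP[t'0 t's].
  rewrite -ball_normE /= -addrA opprD addNKr normrN.
  apply: (le_lt_trans (ler_normD _ _)); rewrite !normrZ !ger0_norm //.
  apply: (@le_lt_trans _ _ (s * k)); last first.
    by rewrite /s mulrAC divfK ?gt_eqF // ltr_pdivrMr // ltr_pMr // ltr1n.
  rewrite /k mulrDr mulr1 mulrDr; apply: ler_wpDr; first exact: ltW.
  by apply: lerD; apply: ler_wpM2r.
have [t t' ts t's|t [t' [ts t's E1]]] := @second_difference V A f x v w s (ltW s0) sf.
  by have [] := dP _ (inb _ _ ts t's).
have [r r' rs r's|r [r' [rs r's E2]]] := @second_difference V A f x w v s (ltW s0) sf.
  by rewrite addrAC; have [] := dP _ (inb _ _ r's rs).
have E : 'D_v ('D_w f) (x + t *: v + t' *: w) =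
         'D_w ('D_v f) (x + r *: w + r' *: v).
  apply: (mulfI (_ : s ^+ 2 != 0)); first by rewrite expf_neq0 // gt_eqF.
  have swap (p p' q m u : R) : p = p' -> p - q - m + u = p' - m - q + u.
    by move=> ->; congr (_ + _); exact: addrAC.
  exact: (etrans (esym E1) (etrans (swap _ _ _ _ _ (congr1 f (addrAC _ _ _))) E2)).
have [_ H1 _] := dP _ (inb _ _ ts t's).
have [_ _ H2] := dP _ (inb _ _ r's rs).
have close (a b c : R) : `|a - c| < e / 2 -> `|b - c| < e / 2 -> `|a - b| <= e.
  move=> ac bc; rewrite -(subrK c a) -addrA; apply: le_trans (ler_normD _ _) _.
  rewrite [leRHS](splitr e); apply: lerD; first exact: ltW.
  by rewrite distrC; exact: ltW.
apply: (close _ _ _ H1); rewrite E [x + r *: w + _]addrAC; exact: H2.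
Qed.

Lemma Schwarz V (A : set V) m (f : V -> 'rV[R]_m) (x v w : V) : open A -> A x ->
  smooth_on A f -> 'D_v ('D_w f) x = 'D_w ('D_v f) x.
Proof.
move=> oA Ax sf; apply/rowP => i.
have E v' w' : 'D_v' ('D_w' f) x 0 i = 'D_v' ('D_w' (fun y => f y 0 i)) x.
  have d := smooth_differentiable (smooth_derive w' sf) Ax.
  have [_ <-] := coord_diff i d.
  apply: near_eq_derive; apply: (filterS (P := A)); last exact: open_nbhs_nbhs.
  move=> y Ay; have dy := smooth_differentiable sf Ay.
  by have [_ ->] := coord_diff i dy.
exact: (etrans (E v w) (etrans (Schwarz_real v w oA Ax (smooth_coord i oA sf))
  (esym (E w v)))).
Qed.

End Vectors.

(** * The Minkowski scalar product *)

Section MinkForm.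
Context {R : realType} {n : nat}.
Implicit Types X Y Z : 'rV[R]_n.+1.

(** Makes the product a single sum over all coordinates, to which the bilinear
    calculus applies coordinate by coordinate. *)
Definition msign (i : 'I_n.+1) : R := if i == ord_max then -1 else 1.

Lemma mink_sumE X Y : mink X Y = \sum_i msign i * (X 0 i * Y 0 i).
Proof.
rewrite big_ord_recr /= /mink /msign eqxx mulN1r; congr (_ - _).
apply: eq_bigr => i _; rewrite ifN ?mul1r //.
by apply/eqP => /(congr1 val) /= /eqP; rewrite ltn_eqF.
Qed.

Lemma minkC X Y : mink X Y = mink Y X.
Proof.
by rewrite !mink_sumE; apply: eq_bigr => i _; rewrite [X _ _ * _]mulrC.
Qed.

Lemma minkDl X Y Z : mink (X + Y) Z = mink X Z + mink Y Z.
Proof.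
rewrite !mink_sumE -big_split; apply: eq_bigr => i _ /=.
by rewrite !mxE mulrDl mulrDr.
Qed.

Lemma minkZl a X Y : mink (a *: X) Y = a * mink X Y.
Proof.
rewrite !mink_sumE big_distrr; apply: eq_bigr => i _ /=.
rewrite !mxE; ring.
Qed.

Lemma minkDr X Y Z : mink X (Y + Z) = mink X Y + mink X Z.
Proof. by rewrite minkC minkDl !(minkC X). Qed.

Lemma minkZr a X Y : mink X (a *: Y) = a * mink X Y.
Proof. by rewrite minkC minkZl minkC. Qed.

Lemma minkNl X Y : mink (- X) Y = - mink X Y.
Proof. by rewrite -scaleN1r minkZl mulN1r. Qed.

Lemma minkNr X Y : mink X (- Y) = - mink X Y.
Proof. by rewrite -scaleN1r minkZr mulN1r. Qed.

Lemma mink0l X : mink 0 X = 0.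
Proof. by rewrite -(scale0r X) minkZl mul0r. Qed.

Lemma mink0r X : mink X 0 = 0.
Proof. by rewrite minkC mink0l. Qed.

Lemma mink_suml (I : Type) (r : seq I) (F : I -> 'rV[R]_n.+1) Y :
  mink (\sum_(i <- r) F i) Y = \sum_(i <- r) mink (F i) Y.
Proof.
by elim: r => [|i r IH]; rewrite ?big_nil ?mink0l // !big_cons minkDl IH.
Qed.

Lemma mink_sumr (I : Type) (r : seq I) (F : I -> 'rV[R]_n.+1) Y :
  mink Y (\sum_(i <- r) F i) = \sum_(i <- r) mink Y (F i).
Proof. by rewrite minkC mink_suml; apply: eq_bigr => i _; rewrite minkC. Qed.

Definition minkE := (minkDl, minkDr, minkNl, minkNr, minkZl, minkZr,
  mink0l, mink0r).

Lemma mink_delta X i : mink X (delta_mx 0 i) = msign i * X 0 i.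
Proof.
rewrite mink_sumE (bigD1 i) //= mxE !eqxx mulr1 big1 ?addr0 // => j ji.
by rewrite mxE (negbTE ji) andbF !mulr0.
Qed.

Lemma msign_neq0 i : msign i != 0.
Proof. by rewrite /msign; case: ifP; rewrite ?oppr_eq0 oner_neq0. Qed.

Lemma mink_nondegenerate X : (forall Y, mink X Y = 0) -> X = 0.
Proof.
move=> X0; apply/rowP => i; rewrite mxE; apply/eqP.
have /eqP := X0 (delta_mx 0 i).
by rewrite mink_delta mulf_eq0 (negbTE (msign_neq0 i)).
Qed.

Lemma mink_diff (V : normedModType R) (f g : V -> 'rV[R]_n.+1) x :
  differentiable f x -> differentiable g x ->
  differentiable (fun y => mink (f y) (g y)) x /\
  forall v, 'D_v (fun y => mink (f y) (g y)) x =
    mink ('D_v f x) (g x) + mink (f x) ('D_v g x).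
Proof.
move=> df dg.
have -> : (fun y => mink (f y) (g y)) =
    fun y => \sum_i msign i * (f y 0 i * g y 0 i).
  by rewrite funeqE => y; rewrite mink_sumE.
have M i := mul_fun_diff (coord_diff i df).1 (coord_diff i dg).1.
have N i := mul_fun_diff (differentiable_cst (msign i) x) (M i).1.
have [D E] := sum_fun_diff (index_enum _) (fun i => (N i).1); split=> // v.
rewrite E !mink_sumE -big_split; apply: eq_bigr => i _ /=.
rewrite (N i).2 (M i).2 (coord_diff i df).2 (coord_diff i dg).2.
by rewrite derive_cst mul0r add0r mulrDr.
Qed.

Lemma smooth_mink (V : normedModType R) (A : set V) (f g : V -> 'rV[R]_n.+1) :
  open A -> smooth_on A f -> smooth_on A g ->
  smooth_on A (fun y => mink (f y) (g y)).
Proof.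
move=> oA sf sg.
apply: (smooth_on_ext (f := fun y => \sum_i msign i * (f y 0 i * g y 0 i))).
- exact: oA.
- by move=> y _; rewrite mink_sumE.
apply: smooth_on_sum => // i; apply: smooth_onM => //.
  exact: smooth_on_cst.
by apply: smooth_onM => //; exact: smooth_coord.
Qed.

End MinkForm.

(** * Symmetric matrices satisfying the Gauss relations *)

Section CartanAlgebra.
Context {R : rcfType} {n : nat}.

(** Used for lists of at most three indices, since n >= 4. *)
Lemma fresh_ord (s : seq 'I_n) : (size s < n)%N -> exists c, c \notin s.
Proof.
move=> sn; apply/existsP; apply: contraLR sn.
rewrite negb_exists -leqNgt => /forallP sA.
rewrite -[X in (X <= _)%N](card_ord n); apply: leq_trans (card_size s).
by apply/subset_leq_card/fintype.subsetP => c _; have := sA c; rewrite negbK.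
Qed.

Ltac distinct := rewrite /= !inE !negb_or /=; repeat (apply/andP; split);
  by [|rewrite eq_sym].

(** The hypotheses are what the Gauss relation says on e_a, e_b, e_c, e_d, after
    replacing e_c, e_d by their sum and difference, and after doing so for e_a,
    e_b as well.  If an entry h a b off the diagonal is nonzero, the second
    relation makes alpha = h c c - h a c * h b c / h a b independent of c, and
    all relations together make h - alpha of rank one.  If h is diagonal, the
    third relation says that of two disjoint pairs of eigenvalues one consists
    of equal ones, so all eigenvalues but one coincide.  No diagonalization is
    involved, hence everything is explicit in the entries of h. *)
Lemma cartan_algebra (h : 'I_n -> 'I_n -> R) : (4 <= n)%N ->
  (forall i j, h i j = h j i) ->
  (forall a b c d, uniq [:: a; b; c; d] -> h a b * h c d = h a c * h b d) ->
  (forall a b c d, uniq [:: a; b; c; d] ->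
     h a b * (h c c - h d d) = h a c * h b c - h a d * h b d) ->
  (forall a b c d, uniq [:: a; b; c; d] ->
     (h a a - h b b) * (h c c - h d d) =
     h a c ^+ 2 - h b c ^+ 2 - h a d ^+ 2 + h b d ^+ 2) ->
  exists (al be : R) (e : 'I_n -> R), \sum_i e i ^+ 2 = 1 /\
    forall i j, h i j = al * (i == j)%:R + be * (e i * e j).
Proof.
move=> n4 hC H1 H2 H3.
have fresh2 (a b : 'I_n) : exists2 c, c != a & c != b.
  have [|c] := @fresh_ord [:: a; b]; first exact: leq_trans n4.
  by rewrite !inE negb_or => /andP[? ?]; exists c.
have fresh3 (a b c : 'I_n) : exists d, [/\ d != a, d != b & d != c].
  have [|d] := @fresh_ord [:: a; b; c]; first exact: n4.
  by rewrite !inE !negb_or => /and3P[? ? ?]; exists d.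
have sum_delta (b : 'I_n) : \sum_i (i == b)%:R ^+ 2 = 1 :> R.
  rewrite (bigD1 b) //= eqxx expr1n big1 ?addr0 // => i /negbTE ->.
  by rewrite expr0n.
have [[a [b [ab hab0]]]|diag] := pselect (exists a b, a != b /\ h a b != 0).
  set p := h a b.
  have [c0 c0a c0b] := fresh2 a b.
  (* The relations below say that h - al has rank one; k is its row of index a. *)
  set al := h c0 c0 - h a c0 * h b c0 / p.
  have Kd c : c != a -> c != b -> p * (h c c - al) = h a c * h b c.
    move=> ca cb; have [->|cc0] := eqVneq c c0; first by rewrite /al; field.
    have /H2 : uniq [:: a; b; c; c0] by distinct.
    rewrite -/p => E; rewrite /al.
    rewrite (_ : _ * _ = p * (h c c - h c0 c0) + h a c0 * h b c0).
      by rewrite E subrK.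
    by field.
  have Kcd c d : c != a -> c != b -> d != a -> d != b -> d != c ->
      p * h c d = h a c * h b d.
    by move=> *; apply/H1; distinct.
  have Kb c : c != a -> c != b -> h a c * (h b b - al) = p * h b c.
    move=> ca cb; have [d [da db dc]] := fresh3 a b c.
    have /H2 : uniq [:: a; c; b; d] by distinct.
    rewrite -/p (hC c b) => E.
    apply: (mulfI hab0); rewrite -/p.
    have -> : p * (h a c * (h b b - al)) =
        p * (h a c * (h b b - h d d)) + h a c * (p * (h d d - al)) by ring.
    rewrite E Kd // mulrBr [p * (h a d * _)]mulrCA (Kcd c d) //; ring.
  have Ka c : c != a -> c != b -> h b c * (h a a - al) = p * h a c.
    move=> ca cb; have [d [da db dc]] := fresh3 a b c.
    have /H2 : uniq [:: b; c; a; d] by distinct.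
    rewrite (hC b a) -/p (hC c a) => E.
    apply: (mulfI hab0); rewrite -/p.
    have -> : p * (h b c * (h a a - al)) =
        p * (h b c * (h a a - h d d)) + h b c * (p * (h d d - al)) by ring.
    have cd : p * h c d = h b c * h a d.
      by rewrite hC Kcd //; [ring|rewrite eq_sym].
    rewrite E Kd // mulrBr [p * (h b d * _)]mulrCA cd; ring.
  have Kab : (h a a - al) * (h b b - al) = p ^+ 2.
    have [d [da db dc]] := fresh3 a b c0.
    have /H3 : uniq [:: a; c0; b; d] by distinct.
    rewrite (hC c0 b) -/p => E.
    have -> : (h a a - al) * (h b b - al) =
      (h a a - h c0 c0) * (h b b - h d d) + (h a a - al) * (h d d - al)
      + (h c0 c0 - al) * (h b b - al) - (h c0 c0 - al) * (h d d - al) by ring.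
    have p2 : p ^+ 2 != 0 by rewrite expf_neq0.
    have E1 : (h a a - al) * (h d d - al) = h a d ^+ 2.
      apply: (mulfI hab0); rewrite -/p mulrCA Kd // mulrCA [_ * h b d]mulrC Ka //.
      ring.
    have E2 : (h c0 c0 - al) * (h b b - al) = h b c0 ^+ 2.
      apply: (mulfI hab0); rewrite -/p mulrA Kd // mulrAC Kb //.
      ring.
    have E3 : (h c0 c0 - al) * (h d d - al) = h c0 d ^+ 2.
      apply: (mulfI p2).
      rewrite -[RHS]exprMn [in RHS]expr2.
      rewrite {1}Kcd // [p * h c0 d](_ : _ = h b c0 * h a d); last first.
        by rewrite hC Kcd //; [ring|rewrite eq_sym].
      have -> : p ^+ 2 * ((h c0 c0 - al) * (h d d - al)) =
        (p * (h c0 c0 - al)) * (p * (h d d - al)) by ring.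
      rewrite !Kd //; ring.
    rewrite E E1 E2 E3; ring.
  set A := h a a - al in Ka Kab.
  have A0 : A != 0.
    apply/eqP => A0; move: Kab; rewrite A0 mul0r => /esym/eqP.
    by rewrite expf_eq0 /= (negbTE hab0).
  pose k i := h a i - al * (i == a)%:R.
  have ka : k a = A by rewrite /k eqxx mulr1.
  have kb : k b = p by rewrite /k eq_sym (negbTE ab) mulr0 subr0.
  have kc c : c != a -> k c = h a c by move=> /negbTE ca; rewrite /k ca mulr0 subr0.
  have K i j : h i j = al * (i == j)%:R + k i * k j / A.
    have KA j' : h a j' = al * (a == j')%:R + k a * k j' / A.
      by rewrite ka mulrAC divff // mul1r /k eq_sym; ring.
    have [->|ia] := eqVneq i a; first exact: KA.
    have [->|ja] := eqVneq j a.
      by rewrite hC KA (negbTE ia) eq_sym (negbTE ia) [k i * _]mulrC.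
    have KB j' : j' != a -> h b j' = al * (b == j')%:R + k b * k j' / A.
      move=> j'a; have [<-|bj'] := eqVneq b j'.
        by rewrite kb mulr1 -expr2 -Kab mulrAC divff // mul1r; ring.
      rewrite mulr0 add0r kb kc // -Ka // 1?eq_sym //; field.
      exact: A0.
    have [->|ib] := eqVneq i b; first exact: KB.
    have [->|jb] := eqVneq j b.
      by rewrite hC KB // (negbTE ib) eq_sym (negbTE ib) [k i * _]mulrC.
    apply: (mulfI hab0); rewrite -/p mulrDr.
    have -> : p * (k i * k j / A) = k i * h b j.
      by rewrite -[RHS](mulfK A0) -[k i * h b j * A]mulrA Ka // -(kc j) //; ring.
    rewrite (kc i) //; have [<-|ij] := eqVneq i j.
      by rewrite -Kd // mulr1; ring.
    by rewrite mulr0 mulr0 add0r; apply: Kcd; rewrite // eq_sym.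
  pose N := \sum_i k i ^+ 2.
  have N0 : 0 < N.
    rewrite /N (bigD1 a) //= ka ltr_pwDl ?exprn_even_gt0 //.
    by apply: sumr_ge0 => i _; exact: sqr_ge0.
  have s0 : Num.sqrt N != 0 by rewrite gt_eqF // sqrtr_gt0.
  have sN : Num.sqrt N ^+ 2 = N by rewrite sqr_sqrtr // ltW.
  set s := Num.sqrt N in s0 sN.
  exists al, (N / A), (fun i => k i / s); split.
    under eq_bigr do rewrite expr_div_n sN.
    by rewrite -mulr_suml divff // gt_eqF.
  move=> i j; rewrite K; congr (_ + _); rewrite -sN; field.
  by rewrite s0 A0.
have hd i j : i != j -> h i j = 0.
  move=> ij; apply/eqP/negP => h0; apply: diag; exists i, j; split => //.
  exact/negP.
have D a b c d : uniq [:: a; b; c; d] ->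
    (h a a = h b b) \/ (h c c = h d d).
  move=> U; have := H3 _ _ _ _ U; move: U.
  rewrite /= !inE !negb_or => /and4P[/and3P[ab ac ad] /andP[bc bd] cd _].
  rewrite (hd _ _ ac) (hd _ _ bc) (hd _ _ ad) (hd _ _ bd) !expr0n /= !subr0 addr0 => /eqP.
  by rewrite mulf_eq0 !subr_eq0 => /orP[] /eqP; [left|right].
have conc b al : (forall c, c != b -> h c c = al) ->
  exists (al be : R) (e : 'I_n -> R), \sum_i e i ^+ 2 = 1 /\
    forall i j, h i j = al * (i == j)%:R + be * (e i * e j).
  move=> hc; exists al, (h b b - al), (fun i => (i == b)%:R); split=> // i j.
  have [<-|ij] := eqVneq i j.
    have [->|ib] := eqVneq i b; first by rewrite /=; ring.
    by rewrite hc //=; ring.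
  rewrite hd //; have [ib|ib] := eqVneq i b; last by rewrite /=; ring.
  have [jb|jb] := eqVneq j b; last by rewrite /=; ring.
  by rewrite ib jb eqxx in ij.
have [[a [b [ab hab]]]|hall] := pselect (exists a b, a != b /\ h a a != h b b).
  have [c ca cb] := fresh2 a b; have [d [da db dc]] := fresh3 a b c.
  have same c' d' : c' != a -> c' != b -> d' != a -> d' != b ->
      h c' c' = h d' d'.
    move=> c'a c'b d'a d'b; have [->//|cd'] := eqVneq c' d'.
    have [|/eqP|//] := D a b c' d'; first by distinct.
    by rewrite (negbTE hab).
  have [||E] := D a c b d; first by distinct.
    move=> hac; apply: (conc b (h c c)) => i ib.
    by have [->//|ia] := eqVneq i a; exact: same.
  apply: (conc a (h c c)) => i ia.
  have [->|ib] := eqVneq i b; last exact: same.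
  by rewrite E; exact: same.
have [a0 _] : exists a : 'I_n, a \notin [::] by apply: fresh_ord; exact: leq_trans n4.
apply: (conc a0 (h a0 a0)) => c _; apply/eqP/negP => hc; apply: hall.
by exists c, a0; split; [apply: contra_notN hc => /eqP ->|exact/negP].
Qed.
End CartanAlgebra.

(** * Euclidean scalar product and orthogonal frames of Minkowski space *)

Section Euclid.
Context {R : realType} {n : nat}.
Implicit Types u v w : 'rV[R]_n.

Definition bvec (i : 'I_n) : 'rV[R]_n := delta_mx 0 i.

Lemma dotC u v : dot u v = dot v u.
Proof. by apply: eq_bigr => i _; rewrite mulrC. Qed.

Lemma dotDl u v w : dot (u + v) w = dot u w + dot v w.
Proof. by rewrite -big_split; apply: eq_bigr => i _; rewrite mxE mulrDl. Qed.

Lemma dotZl a u v : dot (a *: u) v = a * dot u v.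
Proof. by rewrite /dot mulr_sumr; apply: eq_bigr => i _; rewrite mxE mulrA. Qed.

Lemma dotDr u v w : dot u (v + w) = dot u v + dot u w.
Proof. by rewrite dotC dotDl !(dotC u). Qed.

Lemma dotZr a u v : dot u (a *: v) = a * dot u v.
Proof. by rewrite dotC dotZl dotC. Qed.

Lemma dotNl u v : dot (- u) v = - dot u v.
Proof. by rewrite -scaleN1r dotZl mulN1r. Qed.

Lemma dotNr u v : dot u (- v) = - dot u v.
Proof. by rewrite dotC dotNl dotC. Qed.

Lemma dot0l v : dot 0 v = 0.
Proof. by rewrite -(scale0r 0) dotZl mul0r. Qed.

Definition dotE := (dotDl, dotDr, dotNl, dotNr, dotZl, dotZr).

Lemma dot_bvec v i : dot v (bvec i) = v 0 i.
Proof.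
rewrite /dot (bigD1 i) //= mxE !eqxx mulr1 big1 ?addr0 // => j ji.
by rewrite mxE (negbTE ji) andbF mulr0.
Qed.

Lemma dot_bvecs i j : dot (bvec i) (bvec j) = (i == j)%:R.
Proof. by rewrite dot_bvec mxE eqxx eq_sym. Qed.

Lemma dot_gt0 v : v != 0 -> 0 < dot v v.
Proof.
move=> v0; have sq i : 0 <= v 0 i * v 0 i by rewrite -expr2 sqr_ge0.
rewrite lt_def sumr_ge0 // andbT; apply: contra v0 => /eqP v0.
apply/eqP/rowP => i; rewrite mxE; apply/eqP.
have /eqP : v 0 i * v 0 i = 0 by apply: (psumr_eq0P (fun i _ => sq i) v0).
by rewrite mulf_eq0 orbb.
Qed.

Lemma row_bvec v : v = \sum_i v 0 i *: bvec i.
Proof. exact: row_sum_delta. Qed.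

Section DirLin.
Context {W : normedModType R}.
Implicit Types f : 'rV[R]_n -> W.

Lemma derive_dirD f x u v : differentiable f x ->
  'D_(u + v) f x = 'D_u f x + 'D_v f x.
Proof. by move=> df; rewrite !deriveE // linearD. Qed.

Lemma derive_dirZ f x a v : differentiable f x -> 'D_(a *: v) f x = a *: 'D_v f x.
Proof. by move=> df; rewrite !deriveE // linearZ. Qed.

Lemma derive_dir_basis f x v : differentiable f x ->
  'D_v f x = \sum_i v 0 i *: 'D_(bvec i) f x.
Proof.
move=> df; rewrite [in LHS](row_bvec v) deriveE // linear_sum.
by apply: eq_bigr => i _; rewrite linearZ deriveE.
Qed.

End DirLin.

(** Let G be the matrix with rows F i / sqrt l and N, and Q the diagonal matrix
    of signs.  The hypotheses say G Q G^T = Q, so Q G^T Q is a right inverse of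
    G, therefore a left inverse: G^T Q G = Q, which is the identity claimed. *)
Lemma mink_parseval (l : R) (F : 'I_n -> 'rV[R]_n.+1) (N X Y : 'rV[R]_n.+1) :
  0 < l -> (forall i j, mink (F i) (F j) = l * (i == j)%:R) ->
  (forall i, mink N (F i) = 0) -> mink N N = -1 ->
  mink X Y = (\sum_i mink X (F i) * mink Y (F i)) / l - mink X N * mink Y N.
Proof.
move=> l0 FF NF NN.
pose s := Num.sqrt l; have s0 : s != 0 by rewrite gt_eqF // sqrtr_gt0.
have ss : s * s = l by rewrite -expr2 sqr_sqrtr // ltW.
pose g (i : 'I_n.+1) :=
  if unlift ord_max i is Some j then s^-1 *: F j else N.
have gl j : g (lift ord_max j) = s^-1 *: F j by rewrite /g liftK.
have gN : g ord_max = N by rewrite /g unlift_none.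
have gg i j : mink (g i) (g j) = msign i * (i == j)%:R.
  rewrite /msign; case: (unliftP ord_max i) => [i'|] ->;
    case: (unliftP ord_max j) => [j'|] ->; rewrite ?gl ?gN ?minkE.
  - rewrite FF (inj_eq (@lift_inj _ _)) [_ == ord_max]eq_sym.
    rewrite (negbTE (neq_lift _ _)) mul1r.
    by rewrite -ss; field.
  - by rewrite minkC NF mulr0 [_ == ord_max]eq_sym (negbTE (neq_lift _ _)) mulr0.
  - by rewrite NF mulr0 (negbTE (neq_lift _ _)) mulr0.
  - by rewrite NN !eqxx mulr1.
pose G : 'M[R]_n.+1 := \matrix_(i, j) g i 0 j.
pose Q : 'M[R]_n.+1 := \matrix_(i, j) (msign i * (i == j)%:R).
have mulQ (A : 'M[R]_n.+1) i j : (A *m Q) i j = A i j * msign j.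
  rewrite mxE (bigD1 j) //= mxE eqxx mulr1 big1 ?addr0 // => k kj.
  by rewrite mxE (negbTE kj) !mulr0.
have mulQ' (A : 'rV[R]_n.+1) i : (A *m Q) 0 i = A 0 i * msign i.
  rewrite mxE (bigD1 i) //= mxE eqxx mulr1 big1 ?addr0 // => k kj.
  by rewrite mxE (negbTE kj) !mulr0.
have sgn2 i : @msign R n i * msign i = 1.
  by rewrite /msign; case: ifP; rewrite ?mulrNN mulr1.
have QQ : Q *m Q = 1%:M.
  apply/matrixP => i j; rewrite mulQ !mxE.
  have [->|] := eqVneq i j; first by rewrite mulr1 sgn2.
  by rewrite mulr0 mul0r.
have GQG : G *m Q *m G^T = Q.
  apply/matrixP => i j; rewrite [RHS]mxE -gg mink_sumE mxE.
  by apply: eq_bigr => k _; rewrite mulQ !mxE; ring.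
have GG : G^T *m Q *m G = Q.
  have : G *m (Q *m G^T *m Q) = 1%:M by rewrite !mulmxA GQG QQ.
  move=> /mulmx1C E; rewrite -[LHS]mul1mx -QQ -!mulmxA.
  by rewrite [X in _ *m X]mulmxA [X in _ *m X]mulmxA E mulmx1.
have XY : mink X Y = \sum_i msign i * (mink X (g i) * mink Y (g i)).
  have XQ (Z : 'rV[R]_n.+1) i : (Z *m Q *m G^T) 0 i = mink Z (g i).
    rewrite mink_sumE mxE; apply: eq_bigr => k _.
    by rewrite mulQ' !mxE; ring.
  have E1 : mink X Y = (X *m Q *m (Y)^T) 0 0.
    rewrite mink_sumE mxE; apply: eq_bigr => k _.
    by rewrite mulQ' !mxE; ring.
  have QT : Q^T = Q.
    apply/matrixP => i j; rewrite !mxE; have [->//|ij] := eqVneq i j.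
    by rewrite !mulr0.
  have E2 : X *m Q *m Y^T = (X *m Q *m G^T) *m Q *m (Y *m Q *m G^T)^T.
    have E3 : Q *m (G^T *m Q *m G) *m Q = Q by rewrite GG QQ mul1mx.
    rewrite !mulmxA in E3.
    by rewrite !trmx_mul trmxK QT -{1}E3 !mulmxA.
  rewrite E1 E2 mxE; apply: eq_bigr => i _.
  by rewrite mulQ' [X in _ * X]mxE !XQ; ring.
rewrite XY big_ord_recr /= gN /msign eqxx mulN1r; congr (_ - _).
rewrite mulr_suml; apply: eq_bigr => i _.
have -> : widen_ord (leqnSn n) i = lift ord_max i.
  by apply: val_inj; rewrite /= /bump leqNgt ltn_ord.
rewrite eq_sym (negbTE (neq_lift _ _)) mul1r gl !minkE -ss; field.
exact: s0.
Qed.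

End Euclid.

(** * Gauss, Weingarten and Koszul formulas in a conformal chart *)

Section ConformalChart.
Context {R : realType} {n : nat}.
Implicit Types (U : set 'rV[R]_n) (phi nu : 'rV[R]_n -> 'rV[R]_n.+1).

Record conformal_chart U phi nu (lam : 'rV[R]_n -> R) : Prop := {
  cc_open : open U;
  cc_phi : smooth_on U phi;
  cc_nu : smooth_on U nu;
  cc_lam : smooth_on U lam;
  cc_pos : forall x, U x -> 0 < lam x;
  cc_conf : forall x, U x -> forall v w,
    mink ('D_v phi x) ('D_w phi x) = lam x * dot v w;
  cc_unit : forall x, U x -> mink (nu x) (nu x) = -1;
  cc_normal : forall x, U x -> forall v, mink (nu x) ('D_v phi x) = 0 }.

Variables (U : set 'rV[R]_n) (phi nu : 'rV[R]_n -> 'rV[R]_n.+1)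
  (lam : 'rV[R]_n -> R).
Hypothesis cc : conformal_chart U phi nu lam.

Let oU := cc_open cc.
Let sphi := cc_phi cc.
Let snu := cc_nu cc.
Let slam := cc_lam cc.

Let nearU x : U x -> \forall y \near x, U y.
Proof. by move=> Ux; exact: open_nbhs_nbhs. Qed.

Lemma chart_parseval x X Y : U x ->
  mink X Y = (\sum_i mink X ('D_(bvec i) phi x) * mink Y ('D_(bvec i) phi x))
     / lam x - mink X (nu x) * mink Y (nu x).
Proof.
move=> Ux; apply: mink_parseval.
- exact: (cc_pos cc).
- by move=> i j; rewrite (cc_conf cc) // dot_bvecs.
- by move=> i; exact: (cc_normal cc).
- exact: (cc_unit cc).
Qed.

(** The vectors D_v phi and the normal span the space, by Parseval. *)
Lemma tangent_eq x X Y : U x ->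
  (forall v, mink X ('D_v phi x) = mink Y ('D_v phi x)) ->
  mink X (nu x) = mink Y (nu x) -> X = Y.
Proof.
move=> Ux T N; apply: subr0_eq; apply: mink_nondegenerate => Z.
rewrite (chart_parseval _ _ Ux) big1.
  by rewrite !minkE N subrr !mul0r subrr.
by move=> i _; rewrite !minkE T subrr mul0r.
Qed.

Lemma mink_product_rule (f g : 'rV[R]_n -> 'rV[R]_n.+1) (F : 'rV[R]_n -> R) x v :
  smooth_on U f -> smooth_on U g -> U x ->
  (forall y, U y -> mink (f y) (g y) = F y) ->
  mink ('D_v f x) (g x) + mink (f x) ('D_v g x) = 'D_v F x.
Proof.
move=> sf sg Ux fg.
have df := smooth_differentiable sf Ux.
have dg := smooth_differentiable sg Ux.
have [_ E] := mink_diff df dg.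
apply: etrans (esym (E v)) _; apply: near_eq_derive.
exact: filterS (nearU Ux).
Qed.

(** Add the derivatives of (D_b phi, D_c phi) = lam (b, c) along a and of
    (D_a phi, D_c phi) along b, and subtract that of (D_a phi, D_b phi) along c;
    all terms but one cancel because second derivatives commute. *)
Lemma koszul x a b c : U x ->
  mink ('D_a ('D_b phi) x) ('D_c phi x) =
  2^-1 * ('D_a lam x * dot b c + 'D_b lam x * dot a c - 'D_c lam x * dot a b).
Proof.
move=> Ux.
have dl := smooth_differentiable slam Ux.
have D u v w : mink ('D_u ('D_v phi) x) ('D_w phi x)
    + mink ('D_v phi x) ('D_u ('D_w phi) x) = 'D_u lam x * dot v w.
  have sv := smooth_derive v sphi; have sw := smooth_derive w sphi.
  apply: etrans (mink_product_rule u sv sw Ux (fun y Uy => cc_conf cc Uy v w)) _.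
  have [_ E] := mul_fun_diff dl (differentiable_cst (dot v w) x).
  by rewrite E derive_cst mulr0 addr0.
have S u v : 'D_u ('D_v phi) x = 'D_v ('D_u phi) x := Schwarz u v oU Ux sphi.
have {}D u v w : mink ('D_u ('D_v phi) x) ('D_w phi x)
    + mink ('D_u ('D_w phi) x) ('D_v phi x) = 'D_u lam x * dot v w.
  by rewrite -D; congr (_ + _); exact: minkC.
pose m u v w := mink ('D_u ('D_v phi) x) ('D_w phi x).
have Sm u v w : m u v w = m v u w.
  by exact: (congr1 (fun Z => mink Z ('D_w phi x)) (S u v)).
change (m a b c = 2^-1 *
  ('D_a lam x * dot b c + 'D_b lam x * dot a c - 'D_c lam x * dot a b)).
have {}D u v w : m u v w + m u w v = 'D_u lam x * dot v w := D u v w.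
clearbody m.
by rewrite -(D a b c) -(D b a c) -(D c a b) (Sm b a) (Sm c a) (Sm c b); field.
Qed.

Notation h := (second_form phi nu).

Lemma second_formC x v w : U x -> h x v w = h x w v.
Proof. by move=> Ux; rewrite /second_form (Schwarz v w oU Ux sphi). Qed.

Lemma second_formDr x u v w : U x -> h x u (v + w) = h x u v + h x u w.
Proof.
move=> Ux.
have E : 'D_u ('D_(v + w) phi) x = 'D_u ('D_v phi) x + 'D_u ('D_w phi) x.
  have d y : differentiable ('D_y phi) x.
    exact: smooth_differentiable (smooth_derive _ sphi) Ux.
  apply: etrans (deriveD (diff_derivable (d v)) (diff_derivable (d w))).
  apply: near_eq_derive; apply: filterS (nearU Ux) => y Uy.
  exact: derive_dirD (smooth_differentiable sphi Uy).
have alg (X Y N : 'rV[R]_n.+1) : - mink (X + Y) N = - mink X N + - mink Y N.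
  by rewrite minkDl opprD.
exact: etrans (congr1 (fun Z => - mink Z (nu x)) E) (alg _ _ _).
Qed.

Lemma second_formZr x u a v : U x -> h x u (a *: v) = a * h x u v.
Proof.
move=> Ux.
have E : 'D_u ('D_(a *: v) phi) x = a *: 'D_u ('D_v phi) x.
  have d : differentiable ('D_v phi) x.
    exact: smooth_differentiable (smooth_derive _ sphi) Ux.
  apply: etrans (deriveZ a (diff_derivable d)).
  apply: near_eq_derive; apply: filterS (nearU Ux) => y Uy.
  exact: derive_dirZ (smooth_differentiable sphi Uy).
have alg (X N : 'rV[R]_n.+1) : - mink (a *: X) N = a * - mink X N.
  by rewrite minkZl mulrN.
exact: etrans (congr1 (fun Z => - mink Z (nu x)) E) (alg _ _).
Qed.

Lemma weingarten_normal x v : U x -> mink ('D_v nu x) (nu x) = 0.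
Proof.
move=> Ux.
have := mink_product_rule v snu snu Ux (fun y Uy => cc_unit cc Uy).
rewrite derive_cst [X in _ + X]minkC => /eqP.
by rewrite -mulr2n mulrn_eq0 => /eqP.
Qed.

Lemma weingarten x v w : U x -> mink ('D_v nu x) ('D_w phi x) = h x v w.
Proof.
move=> Ux.
have := mink_product_rule v snu (smooth_derive w sphi) Ux
  (fun y Uy => cc_normal cc Uy w).
rewrite derive_cst => /eqP; rewrite addr_eq0 => /eqP ->.
by rewrite minkC.
Qed.

(** For orthogonal a, b the tangential part of D_a D_b phi is a combination of
    D_a phi and D_b phi.  Hence (D_a D_b phi, D_d phi) vanishes on U, and so does
    its derivative along c; likewise with b and c exchanged.  The third
    derivatives agree, so (D_a D_b phi, D_c D_d phi) is symmetric in b and c, and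
    only the normal parts contribute to it. *)
Lemma gauss x a b c d : U x ->
  dot a b = 0 -> dot a c = 0 -> dot a d = 0 ->
  dot b c = 0 -> dot b d = 0 -> dot c d = 0 ->
  h x a b * h x c d = h x a c * h x b d.
Proof.
move=> Ux ab ac ad bc bd cd.
have T a' b' d' : dot a' b' = 0 -> dot a' d' = 0 -> dot b' d' = 0 ->
  forall y, U y -> mink ('D_a' ('D_b' phi) y) ('D_d' phi y) = 0.
  by move=> ab' ad' bd' y Uy; rewrite koszul // ab' ad' bd' !mulr0 !addr0 subr0 mulr0.
have T' a' b' c' d' : dot a' b' = 0 -> dot a' d' = 0 -> dot b' d' = 0 ->
    mink ('D_c' ('D_a' ('D_b' phi)) x) ('D_d' phi x)
    + mink ('D_a' ('D_b' phi) x) ('D_c' ('D_d' phi) x) = 0.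
  move=> ab' ad' bd'.
  have s2 := smooth_derive a' (smooth_derive b' sphi).
  have := mink_product_rule c' s2 (smooth_derive d' sphi) Ux (T _ _ _ ab' ad' bd').
  by rewrite derive_cst.
(* Schwarz's theorem for D_b phi, for phi near x, and for D_c phi. *)
have third : 'D_c ('D_a ('D_b phi)) x = 'D_b ('D_a ('D_c phi)) x.
  apply: etrans (Schwarz c a oU Ux (smooth_derive b sphi)) _.
  apply: etrans _ (Schwarz a b oU Ux (smooth_derive c sphi)).
  apply: near_eq_derive; apply: filterS (nearU Ux) => y Uy.
  exact: Schwarz oU Uy sphi.
have P a' b' c' d' : dot a' b' = 0 -> dot c' d' = 0 ->
    dot a' c' = 0 -> dot a' d' = 0 -> dot b' c' = 0 -> dot b' d' = 0 ->
    mink ('D_a' ('D_b' phi) x) ('D_c' ('D_d' phi) x) = - (h x a' b' * h x c' d').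
  move=> ab' cd' ac' ad' bc' bd'.
  pose l v := 'D_v lam x.
  have K u v i : dot u v = 0 ->
      mink ('D_u ('D_v phi) x) ('D_(bvec i) phi x) =
      2^-1 * (l u * v 0 i + l v * u 0 i).
    move=> uv; apply: etrans (koszul u v (bvec i) Ux) _.
    by rewrite uv mulr0 subr0 !dot_bvec.
  apply: etrans (chart_parseval _ _ Ux) _.
  have alg (S p q : R) : S = 0 -> S / lam x - p * q = - (- p * - q).
    by move=> ->; rewrite mul0r sub0r mulrNN.
  apply: alg.
  transitivity (\sum_i (2^-1 * (l a' * b' 0 i + l b' * a' 0 i)) *
                        (2^-1 * (l c' * d' 0 i + l d' * c' 0 i))).
    apply: eq_bigr => i _.
    exact: (f_equal2 *%R (K a' b' i ab') (K c' d' i cd')).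
  clearbody l.
  transitivity (2^-1 * 2^-1 * (l a' * l c' * dot b' d' + l a' * l d' * dot b' c'
                 + l b' * l c' * dot a' d' + l b' * l d' * dot a' c')).
    rewrite /dot !mulr_sumr -!big_split mulr_sumr; apply: eq_bigr => i _ /=.
    by ring.
  by rewrite ac' ad' bc' bd' !mulr0 !addr0 mulr0.
have cb : dot c b = 0 by rewrite dotC.
have alg (X Y Z Z' p q : R) : X + Z = 0 -> Y + Z' = 0 -> X = Y ->
    Z = - p -> Z' = - q -> p = q.
  by move=> E1 E2 E3 E4 E5; lra.
exact: (alg _ _ _ _ _ _ (T' a b c d ab ad bd) (T' a c b d ac ad cd)
  (congr1 (fun Z => mink Z ('D_d phi x)) third)
  (P a b c d ab cd ac ad bc bd) (P a c b d ac bd ab ad cb cd)).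
Qed.

End ConformalChart.

(** * The algebraic form of the second fundamental form *)

Section CartanForm.
Context {R : realType} {n : nat}.
Implicit Types u v w : 'rV[R]_n.

Lemma bilin_basis (b : 'rV[R]_n -> 'rV[R]_n -> R) :
  (forall u v, b u v = b v u) -> (forall u v w, b u (v + w) = b u v + b u w) ->
  (forall u a v, b u (a *: v) = a * b u v) ->
  forall v w, b v w = \sum_i \sum_j v 0 i * w 0 j * b (bvec i) (bvec j).
Proof.
move=> bC bD bZ v w.
have sumr u v' : b u v' = \sum_i v' 0 i * b u (bvec i).
  rewrite [in LHS](row_bvec v').
  elim: (index_enum _) => [|i r IH].
    by rewrite !big_nil -(scale0r 0) bZ mul0r.
  by rewrite !big_cons bD bZ IH.
rewrite bC sumr; apply: eq_bigr => i _.
rewrite bC sumr mulr_sumr; apply: eq_bigr => j _.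
by rewrite mulrA.
Qed.

(** The sums and differences of two basis vectors are orthogonal to each other and
    to the remaining basis vectors; on them the hypothesis becomes the three
    index relations of [cartan_algebra]. *)
Lemma cartan_form (b : 'rV[R]_n -> 'rV[R]_n -> R) : (4 <= n)%N ->
  (forall u v, b u v = b v u) -> (forall u v w, b u (v + w) = b u v + b u w) ->
  (forall u a v, b u (a *: v) = a * b u v) ->
  (forall p q r s, dot p q = 0 -> dot p r = 0 -> dot p s = 0 ->
     dot q r = 0 -> dot q s = 0 -> dot r s = 0 -> b p q * b r s = b p r * b q s) ->
  exists (al be : R) (e : 'rV[R]_n), dot e e = 1 /\
    forall v w, b v w = al * dot v w + be * (dot e v * dot e w).
Proof.
move=> n4 bC bD bZ gauss.
have bN u v : b u (- v) = - b u v by rewrite -scaleN1r bZ mulN1r.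
have bDl u v w : b (u + v) w = b u w + b v w by rewrite bC bD !(bC w).
have bNl u v : b (- u) v = - b u v by rewrite bC bN bC.
have ort i j : i != j -> dot (bvec i : 'rV[R]_n) (bvec j) = 0.
  by move=> /negbTE ij; rewrite dot_bvecs ij.
have ort1 i : dot (bvec i : 'rV[R]_n) (bvec i) = 1 by rewrite dot_bvecs eqxx.
pose h i j := b (bvec i) (bvec j).
have uq (p q r s : 'I_n) : uniq [:: p; q; r; s] ->
    [/\ p != q, p != r & p != s] /\ [/\ q != r, q != s & r != s].
  by rewrite /= !inE !negb_or => /and4P[/and3P[pq pr ps] /andP[qr qs] rs _].
have ortD p r s : p != r -> p != s -> dot (bvec p) (bvec r + bvec s : 'rV[R]_n) = 0.
  by move=> pr ps; rewrite dotDr !ort // addr0.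
have ortB p r s : p != r -> p != s -> dot (bvec p) (bvec r - bvec s : 'rV[R]_n) = 0.
  by move=> pr ps; rewrite dotDr dotNr !ort // subr0.
have ortDB r s : r != s -> dot (bvec r + bvec s) (bvec r - bvec s : 'rV[R]_n) = 0.
  by move=> rs; rewrite !dotE !ort1 (ort _ _ rs) (ort s r) 1?eq_sym //; ring.
have H1 p q r s : uniq [:: p; q; r; s] -> h p q * h r s = h p r * h q s.
  by move=> /uq[[? ? ?] [? ? ?]]; apply: gauss; exact: ort.
have hC i j : h i j = h j i by exact: bC.
have H1' p q r s : uniq [:: p; q; r; s] -> h p r * h q s = h p s * h q r.
  move=> U; have [[pq pr ps] [qr qs rs]] := uq _ _ _ _ U.
  have /H1 : uniq [:: p; r; s; q].
    by rewrite /= !inE !negb_or pr ps pq rs ![_ == q]eq_sym qr qs.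
  by rewrite (hC s) (hC r q) mulrC => <-; rewrite mulrC.
have H2 p q r s : uniq [:: p; q; r; s] ->
    h p q * (h r r - h s s) = h p r * h q r - h p s * h q s.
  move=> U; have h1 := H1 _ _ _ _ U; have h2 := H1' _ _ _ _ U.
  have [[pq pr ps] [qr qs rs]] := uq _ _ _ _ U.
  have E : b (bvec p) (bvec r + bvec s) * b (bvec q) (bvec r - bvec s) =
           b (bvec p) (bvec q) * b (bvec r + bvec s) (bvec r - bvec s).
    apply: gauss; [exact: ortD|exact: ort|exact: ortB| |exact: ortDB|exact: ortB].
    by rewrite dotC ortD.
  move: E; rewrite !bDl !bD !bN -!/(h _ _) (hC s r) => E.
  have -> : h p q * (h r r - h s s) =
    h p q * (h r r - h r s + (h r s - h s s)) by ring.
  rewrite -E; move: h2 => /eqP; rewrite -subr_eq0 => /eqP h2.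
  have -> : (h p r + h p s) * (h q r - h q s) = h p r * h q r - h p s * h q s
    - (h p r * h q s - h p s * h q r) by ring.
  by rewrite h2 subr0.
have H3 p q r s : uniq [:: p; q; r; s] ->
     (h p p - h q q) * (h r r - h s s) =
     h p r ^+ 2 - h q r ^+ 2 - h p s ^+ 2 + h q s ^+ 2.
  move=> U; have h2 := H1' _ _ _ _ U.
  have [[pq pr ps] [qr qs rs]] := uq _ _ _ _ U.
  have E : b (bvec p + bvec q) (bvec r + bvec s) *
           b (bvec p - bvec q) (bvec r - bvec s) =
           b (bvec p + bvec q) (bvec p - bvec q) *
           b (bvec r + bvec s) (bvec r - bvec s).
    apply: gauss; [| exact: ortDB | | | exact: ortDB |].
    - by rewrite dotDl !ortD // addr0.
    - by rewrite dotDl !ortB // addr0.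
    - by rewrite dotC dotDl dotNl !ortD // subr0.
    - by rewrite dotDl dotNl !ortB // subr0.
  move: E; rewrite !bDl !bNl !bD !bN -!/(h _ _) (hC s r) (hC q p) => E.
  have -> : (h p p - h q q) * (h r r - h s s) =
    (h p p - h p q + (h p q - h q q)) * (h r r - h r s + (h r s - h s s)).
    by ring.
  rewrite -E; move: h2 => /eqP; rewrite -subr_eq0 => /eqP h2.
  have -> : (h p r + h p s + (h q r + h q s)) * (h p r - h p s - (h q r - h q s)) =
    h p r ^+ 2 - h q r ^+ 2 - h p s ^+ 2 + h q s ^+ 2
    + 2 * (h p r * h q s - h p s * h q r) by ring.
  by rewrite h2 mulr0 addr0.
have [al [be [e [e1 he]]]] := cartan_algebra n4 hC H1 H2 H3.
exists al, be, (\row_i e i); split.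
  by rewrite /dot -[RHS]e1; apply: eq_bigr => i _; rewrite !mxE -expr2.
move=> v w; rewrite (bilin_basis bC bD bZ).
have E1 : dot v w = \sum_i \sum_j v 0 i * w 0 j * (i == j)%:R.
  apply: eq_bigr => i _; rewrite (bigD1 i) //= eqxx mulr1 big1 ?addr0 // => j.
  by rewrite eq_sym => /negbTE ->; rewrite mulr0.
have E2 : dot (\row_i e i) v * dot (\row_i e i) w =
    \sum_i \sum_j v 0 i * w 0 j * (e i * e j).
  rewrite /dot mulr_suml; apply: eq_bigr => i _.
  by rewrite mulr_sumr; apply: eq_bigr => j _; rewrite !mxE; ring.
rewrite E1 E2 !mulr_sumr -big_split; apply: eq_bigr => i _ /=.
rewrite !mulr_sumr -big_split; apply: eq_bigr => j _ /=.
by rewrite -/(h i j) he; ring.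
Qed.

End CartanForm.

(** * The unit normal and the Codazzi equation *)

Section ChartLemmas.
Context {R : realType} {n : nat}.
Implicit Types (U V : set 'rV[R]_n) (phi nu : 'rV[R]_n -> 'rV[R]_n.+1).

Lemma conformal_chart_sub U V phi nu lam : open V -> V `<=` U ->
  conformal_chart U phi nu lam -> conformal_chart V phi nu lam.
Proof.
move=> oV VU cc; split=> //.
- exact: smooth_on_sub VU (cc_phi cc).
- exact: smooth_on_sub VU (cc_nu cc).
- exact: smooth_on_sub VU (cc_lam cc).
- by move=> x /VU; exact: (cc_pos cc).
- by move=> x /VU; exact: (cc_conf cc).
- by move=> x /VU; exact: (cc_unit cc).
- by move=> x /VU; exact: (cc_normal cc).
Qed.

(** Subtract from the timelike basis vector T its tangential part.  The result N
    satisfies (N, N) = (N, T) = -1 - sum_i (T, D_i phi)^2 / lam < 0, so it can be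
    normalized at every point of U. *)
Lemma exists_normal (i0 : 'I_n) U phi lam : open U -> smooth_on U phi ->
  (forall x, U x -> 0 < lam x /\
     forall v w, metric phi x v w = lam x * dot v w) ->
  exists nu, conformal_chart U phi nu lam.
Proof.
move=> oU sphi conf.
pose d i := 'D_(bvec i) phi.
have sd i : smooth_on U (d i) by exact: smooth_derive.
have dd x i j : U x -> mink (d i x) (d j x) = lam x * (i == j)%:R.
  by move=> Ux; rewrite -dot_bvecs; have [_] := conf _ Ux; exact.
have slam : smooth_on U lam.
  apply: (smooth_on_ext (f := fun x => mink (d i0 x) (d i0 x))) => //.
    by move=> x Ux; rewrite dd // eqxx mulr1.
  exact: smooth_mink.
pose T : 'rV[R]_n.+1 := delta_mx 0 ord_max.
have TT : mink T T = -1.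
  by rewrite mink_delta mxE !eqxx mulr1 /msign eqxx.
have l0 x : U x -> lam x != 0 by move=> /conf[/gt_eqF ->].
pose c i x := mink T (d i x) * (lam x)^-1.
pose N x := T - \sum_i c i x *: d i x.
have sc i : smooth_on U (c i).
  apply: smooth_onM => //; last exact: smooth_onV.
  by apply: smooth_mink => //; exact: smooth_on_cst.
have sN : smooth_on U N.
  apply: smooth_onB => //; first exact: smooth_on_cst.
  by apply: smooth_on_sum => // i; exact: smooth_on_scale.
have Nd x i : U x -> mink (N x) (d i x) = 0.
  move=> Ux; rewrite minkDl minkNl mink_suml (bigD1 i) //= big1.
    by rewrite addr0 minkZl dd // eqxx mulr1 /c mulfVK ?subrr // l0.
  by move=> j ji; rewrite minkZl dd // (negbTE ji) !mulr0.
have NT x : U x -> mink (N x) T = -1 - \sum_i mink T (d i x) ^+ 2 / lam x.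
  move=> Ux; rewrite minkDl minkNl mink_suml TT; congr (_ - _).
  apply: eq_bigr => i _; rewrite minkZl [mink (d i x) _]minkC /c; ring.
have NN x : U x -> mink (N x) (N x) = mink (N x) T.
  move=> Ux; rewrite [X in mink _ X](_ : N x = T - \sum_i c i x *: d i x) //.
  rewrite minkDr minkNr mink_sumr big1 ?subr0 // => i _.
  by rewrite minkZr Nd // mulr0.
have N0 x : U x -> 0 < - mink (N x) (N x).
  move=> Ux; rewrite NN // NT // opprB opprK ltr_wpDl // sumr_ge0 // => i _.
  by rewrite mulr_ge0 ?sqr_ge0 // invr_ge0 ltW //; have [] := conf _ Ux.
pose k x := (Num.sqrt (- mink (N x) (N x)))^-1.
have sk : smooth_on U k.
  apply: smooth_onV => //; first by move=> x Ux; rewrite gt_eqF // sqrtr_gt0 N0.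
  by apply: smooth_on_sqrt => //; apply: smooth_onN => //; exact: smooth_mink.
exists (fun x => k x *: N x); split=> //.
- exact: smooth_on_scale.
- by move=> x /conf[].
- by move=> x Ux v w; have [_] := conf _ Ux; exact.
- move=> x Ux; rewrite minkZl minkZr mulrA -expr2 /k exprVn.
  rewrite sqr_sqrtr; last exact: ltW (N0 _ Ux).
  by rewrite invrN mulNr mulVf //; have := N0 _ Ux; rewrite oppr_gt0 => /lt_eqF ->.
- move=> x Ux v; rewrite minkZl.
  have dphi := smooth_differentiable sphi Ux.
  rewrite (derive_dir_basis v dphi) mink_sumr big1 ?mulr0 // => i _.
  by apply: etrans (minkZr _ _ _) _; rewrite -/(d i) Nd // mulr0.
Qed.

(** The linear map v |-> ((u, v), (w, v)) from R^n to R^2 has a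
    nonzero kernel when n > 2. *)
Lemma exists_orthogonal2 (u w : 'rV[R]_n) : (2 < n)%N ->
  exists v, [/\ v != 0, dot u v = 0 & dot w v = 0].
Proof.
move=> n2; pose M : 'M[R]_(n, 2) := \matrix_(i, j) (if j == 0 then u 0 i else w 0 i).
have : kermx M != 0.
  rewrite -mxrank_eq0 -lt0n mxrank_ker subn_gt0.
  exact: leq_ltn_trans (rank_leq_col M) n2.
move=> /rowV0Pn[v /sub_kermxP vM v0]; exists v; split=> //.
- move/rowP: vM => /(_ 0); rewrite !mxE => E; rewrite -[RHS]E.
  by apply: eq_bigr => i _; rewrite mxE mulrC.
- move/rowP: vM => /(_ 1); rewrite !mxE => E; rewrite -[RHS]E.
  by apply: eq_bigr => i _; rewrite mxE mulrC.
Qed.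

Lemma smooth_dot V (eta : 'rV[R]_n -> 'rV[R]_n) v : open V -> smooth_on V eta ->
  smooth_on V (fun x => dot (eta x) v).
Proof.
move=> oV se; rewrite /dot; apply: smooth_on_sum => // i.
by apply: smooth_onM => //; [exact: smooth_coord|exact: smooth_on_cst].
Qed.

Lemma derive_mul_vanishing (b p q : 'rV[R]_n -> R) x w :
  differentiable b x -> differentiable p x -> differentiable q x ->
  p x = 0 -> q x = 0 ->
  differentiable (fun y => b y * (p y * q y)) x /\
  'D_w (fun y => b y * (p y * q y)) x = 0.
Proof.
move=> db dp dq p0 q0; have [dpq Dpq] := mul_fun_diff dp dq.
have [D E] := mul_fun_diff db dpq; split=> //.
by rewrite E Dpq p0 q0 !(mul0r, mulr0, addr0).
Qed.

Lemma weingarten_kernel U phi nu lam (al be : R) (eta : 'rV[R]_n) x v :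
  conformal_chart U phi nu lam -> U x ->
  (forall v w, second_form phi nu x v w =
     al * metric phi x v w + be * (dot eta v * dot eta w)) ->
  dot eta v = 0 -> 'D_v nu x = al *: 'D_v phi x.
Proof.
move=> cc Ux H ev; apply: (tangent_eq cc Ux) => [u|].
  rewrite (weingarten cc) // H ev mul0r mulr0 addr0 minkZl //.
rewrite (weingarten_normal cc) // minkZl minkC (cc_normal cc) // mulr0 //.
Qed.

Lemma codazzi_algebra (Q Q' A B a l L D c z s : R) :
  Q + A = (D * L + a * l) * s -> Q' + B = c * z -> z = 0 -> Q = Q' ->
  A = a * (2^-1 * (l * s)) -> B = - (a * (2^-1 * (l * s))) ->
  D * (L * s) = 0.
Proof. by move=> E1 E2 z0 E3 E4 E5; rewrite z0 mulr0 in E2; lra. Qed.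

(** Choose v in the kernel of eta at x and orthogonal to w.  Differentiate
    (D_v nu, D_v phi) = h(v, v) along w and (D_w nu, D_v phi) = h(w, v) along v.
    The terms with eta vanish at x to second order; the second derivatives of nu
    agree; those of phi are given by Koszul's formula, as D_v nu = alpha D_v phi
    and D_w nu = alpha D_w phi at x.  The difference of the two equations is
    lam (v, v) D_w alpha = 0. *)
Lemma codazzi V phi nu lam (al be : 'rV[R]_n -> R) (eta : 'rV[R]_n -> 'rV[R]_n) :
  (2 < n)%N -> conformal_chart V phi nu lam ->
  smooth_on V al -> smooth_on V be -> smooth_on V eta ->
  (forall x, V x -> forall v w, second_form phi nu x v w =
     al x * metric phi x v w + be x * (dot (eta x) v * dot (eta x) w)) ->
  forall x w, V x -> dot (eta x) w = 0 -> 'D_w al x = 0.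
Proof.
move=> n2 cc sal sbe seta H x w Vx ew.
have [v [v0 ev wv]] := exists_orthogonal2 (eta x) w n2.
have oV := cc_open cc; have slam := cc_lam cc.
have da := smooth_differentiable sal Vx; have dl := smooth_differentiable slam Vx.
have db := smooth_differentiable sbe Vx.
have de u := smooth_differentiable (smooth_dot u oV seta) Vx.
(* As z and v are in the kernel of eta at x, the eta term of h(z, v) has zero
   differential there. *)
have F z w' : dot (eta x) z = 0 ->
  mink ('D_w' ('D_z nu) x) ('D_v phi x) + mink ('D_z nu x) ('D_w' ('D_v phi) x) =
  ('D_w' al x * lam x + al x * 'D_w' lam x) * dot z v.
  move=> ez.
  have s1 := smooth_derive z (cc_nu cc); have s2 := smooth_derive v (cc_phi cc).
  have FE y : V y -> mink ('D_z nu y) ('D_v phi y) =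
     al y * lam y * dot z v + be y * (dot (eta y) z * dot (eta y) v).
    move=> Vy; apply: etrans (weingarten cc z v Vy) _.
    apply: etrans (H y Vy z v) _; congr (_ + _).
    by rewrite -mulrA; congr (_ * _); exact: (cc_conf cc Vy).
  apply: etrans (mink_product_rule cc w' s1 s2 Vx FE) _.
  have [d1 D1] := mul_fun_diff da dl.
  have [d2 D2] := mul_fun_diff d1 (differentiable_cst (dot z v) x).
  have [d3 D3] := derive_mul_vanishing w' db (de z) (de v) ez ev.
  apply: etrans (deriveD (diff_derivable d2) (diff_derivable d3)) _.
  by rewrite D3 addr0 D2 D1 derive_cst mulr0 addr0.
have Fw := F v w ev; have Fv := F w v ew.
have S : 'D_w ('D_v nu) x = 'D_v ('D_w nu) x := Schwarz w v oV Vx (cc_nu cc).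
have Wv := weingarten_kernel cc Vx (H x Vx) ev.
have Ww := weingarten_kernel cc Vx (H x Vx) ew.
have K1 : mink ('D_v nu x) ('D_w ('D_v phi) x) =
    al x * (2^-1 * ('D_w lam x * dot v v)).
  rewrite Wv minkZl minkC; congr (_ * _).
  apply: etrans (koszul cc w v v Vx) _; rewrite wv; ring.
have K2 : mink ('D_w nu x) ('D_v ('D_v phi) x) =
    - (al x * (2^-1 * ('D_w lam x * dot v v))).
  rewrite Ww minkZl minkC -mulrN; congr (_ * _).
  apply: etrans (koszul cc v v w Vx) _; rewrite [dot v w]dotC wv; ring.
have SS : mink ('D_w ('D_v nu) x) ('D_v phi x) = mink ('D_v ('D_w nu) x) ('D_v phi x).
  exact: (congr1 (fun Z => mink Z ('D_v phi x)) S).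
have := codazzi_algebra Fw Fv wv SS K1 K2.
move=> /eqP; rewrite mulf_eq0 => /orP[/eqP //|].
by rewrite mulf_eq0 (gt_eqF (cc_pos cc Vx)) (gt_eqF (dot_gt0 v0)).
Qed.

End ChartLemmas.

(** * Smoothness of the coefficients *)

Section RankOneInvariants.
Context {R : realType} {n : nat}.

(** T = be (P - 1/n) where P is the orthogonal projection onto e. *)
Lemma rank_one_invariants (S : 'M[R]_n) (al be : R) (e : 'rV[R]_n) :
  (2 < n)%N -> dot e e = 1 ->
  (forall i j, S i j = al * (i == j)%:R + be * (e 0 i * e 0 j)) ->
  let T := S - (\tr S / n%:R)%:M in
  [/\ \tr S / n%:R = al + be / n%:R,
      \tr (T *m T) = be ^+ 2 * (1 - n%:R^-1)
    & \tr (T *m T *m T) = be ^+ 3 * ((1 - n%:R^-1) * (1 - 2 * n%:R^-1))].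
Proof.
move=> n2 e1 SE.
have n0 : n%:R != 0 :> R by rewrite pnatr_eq0 -lt0n; apply: ltn_trans n2.
have [P [PP trP SP]] : exists P : 'M[R]_n,
    [/\ P *m P = P, \tr P = 1 & S = al%:M + be *: P].
  exists (e^T *m e).
  have ee : e *m e^T = 1%:M.
    apply/matrixP => i j; rewrite !ord1 !mxE eqxx -[RHS]e1.
    by apply: eq_bigr => k _; rewrite mxE.
  split; first by rewrite mulmxA -(mulmxA e^T) ee mulmx1.
    by rewrite mxtrace_mulC ee mxtrace1.
  apply/matrixP => i j; rewrite SE !mxE mulr_natr; congr (_ + _ * _).
  by rewrite big_ord1 !mxE.
have m : \tr S / n%:R = al + be / n%:R.
  by rewrite SP mxtraceD mxtraceZ mxtrace_scalar trP mulr1 -mulr_natr; field.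
pose c := n%:R^-1 : R; pose D := P - c%:M.
have cn : c * n%:R = 1 by rewrite mulVf.
have trD : \tr D = 0.
  by rewrite /D linearB /= trP mxtrace_scalar -mulr_natr cn subrr.
have trDP : \tr (D *m P) = 1 - c.
  by rewrite mulmxBl PP mul_scalar_mx linearB /= mxtraceZ trP mulr1.
have TD : S - (\tr S / n%:R)%:M = be *: D.
  rewrite m SP; apply/matrixP => i j; rewrite !mxE /c.
  by case: (i == j); rewrite ?mulr1n ?mulr0n; ring.
have DD : D *m D = (1 - 2 * c) *: P + (c ^+ 2)%:M.
  rewrite {1}/D mulmxBl mul_scalar_mx /D mulmxBr PP mul_mx_scalar.
  apply/matrixP => i j; rewrite !mxE.
  by case: (i == j); rewrite ?mulr1n ?mulr0n; ring.
rewrite /= TD m; split=> //.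
  rewrite -scalemxAl -scalemxAr !mxtraceZ DD mxtraceD mxtraceZ trP mxtrace_scalar.
  by rewrite (_ : c ^+ 2 *+ n = c) -/c; [ring|rewrite -mulr_natr expr2 -mulrA cn mulr1].
rewrite -!scalemxAl -!scalemxAr -!scalemxAl !mxtraceZ.
rewrite mxtrace_mulC [in X in D *m X]DD mulmxDr -scalemxAr mul_mx_scalar.
rewrite mxtraceD !mxtraceZ trD trDP -/c; ring.
Qed.

End RankOneInvariants.

Section SmoothCoefficients.
Context {R : realType} {n : nat}.
Implicit Types (V : set 'rV[R]_n).
Variables (U : set 'rV[R]_n) (phi nu : 'rV[R]_n -> 'rV[R]_n.+1)
  (lam : 'rV[R]_n -> R).
Hypothesis n4 : (4 <= n)%N.
Hypothesis cc : conformal_chart U phi nu lam.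

Let oU := cc_open cc.

Lemma smooth_mulmx V (A B : 'rV[R]_n -> 'M[R]_n) : open V ->
  (forall i j, smooth_on V (fun x => A x i j)) ->
  (forall i j, smooth_on V (fun x => B x i j)) ->
  forall i j, smooth_on V (fun x => (A x *m B x) i j).
Proof.
move=> oV sA sB i j.
apply: (smooth_on_ext (f := fun x => \sum_k A x i k * B x k j)) => //.
  by move=> x _; rewrite mxE.
by apply: smooth_on_sum => // k; exact: smooth_onM.
Qed.

Lemma smooth_mxtrace V (A : 'rV[R]_n -> 'M[R]_n) : open V ->
  (forall i j, smooth_on V (fun x => A x i j)) ->
  smooth_on V (fun x => \tr (A x)).
Proof. by move=> oV sA; exact: smooth_on_sum. Qed.

Definition shape_mx x : 'M[R]_n :=
  \matrix_(i, j) (second_form phi nu x (bvec i) (bvec j) / lam x).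
Definition mean_shape x : R := \tr (shape_mx x) / n%:R.
Definition tracefree x : 'M[R]_n := shape_mx x - (mean_shape x)%:M.
Definition tracefree2 x : R := \tr (tracefree x *m tracefree x).
Definition tracefree3 x : R := \tr (tracefree x *m tracefree x *m tracefree x).
(** By [rank_one_invariants] this is the coefficient of the rank one part.  Where
    T = 0 the quotient is 0 / 0, that is 0, which is the right value. *)
Definition beta_of x : R := n%:R / (n%:R - 2) * (tracefree3 x / tracefree2 x).
Definition alpha_of x : R := mean_shape x - beta_of x / n%:R.

Lemma smooth_second_form v w : smooth_on U (fun x => second_form phi nu x v w).
Proof.
apply: smooth_onN => //; apply: smooth_mink => //; last exact: (cc_nu cc).
exact: smooth_derive (smooth_derive w (cc_phi cc)).
Qed.

Lemma smooth_shape i j : smooth_on U (fun x => shape_mx x i j).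
Proof.
apply: (smooth_on_ext (f := fun x =>
  second_form phi nu x (bvec i) (bvec j) * (lam x)^-1)) => //.
  by move=> x _; rewrite mxE.
apply: smooth_onM => //; first exact: smooth_second_form.
apply: smooth_onV => //; last exact: (cc_lam cc).
by move=> x Ux; rewrite gt_eqF // (cc_pos cc).
Qed.

Lemma smooth_mean : smooth_on U mean_shape.
Proof.
apply: smooth_onM => //; last exact: smooth_on_cst.
exact: smooth_mxtrace smooth_shape.
Qed.

Lemma smooth_tracefree i j : smooth_on U (fun x => tracefree x i j).
Proof.
apply: (smooth_on_ext (f := fun x =>
  shape_mx x i j - mean_shape x * (i == j)%:R)) => //.
  by move=> x _; rewrite [RHS]mxE [X in _ = _ + X]mxE [X in _ = _ - X]mxE mulr_natr.
apply: smooth_onB => //; first exact: smooth_shape.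
by apply: smooth_onM => //; [exact: smooth_mean|exact: smooth_on_cst].
Qed.

Lemma smooth_tracefree2 : smooth_on U tracefree2.
Proof.
by apply: smooth_mxtrace => //; apply: smooth_mulmx => //; exact: smooth_tracefree.
Qed.

Lemma smooth_tracefree3 : smooth_on U tracefree3.
Proof.
apply: smooth_mxtrace => //; apply: smooth_mulmx => //; last exact: smooth_tracefree.
by apply: smooth_mulmx => //; exact: smooth_tracefree.
Qed.

(** The pointwise coefficients given by [cartan_form] can only be alpha_of and
    beta_of, by [rank_one_invariants]. *)
Lemma shape_spec x : U x ->
  (beta_of x == 0) = (tracefree2 x == 0) /\
  exists2 e : 'rV[R]_n, dot e e = 1 &
    forall v w, second_form phi nu x v w =
      lam x * (alpha_of x * dot v w + beta_of x * (dot e v * dot e w)).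
Proof.
move=> Ux; have l0 : lam x != 0 by rewrite gt_eqF // (cc_pos cc).
have [al [be [e [e1 he]]]] := cartan_form n4
  (fun v w => second_formC cc v w Ux) (fun u v w => second_formDr cc u v w Ux)
  (fun u a v => second_formZr cc u a v Ux)
  (fun p q r s => @gauss _ _ _ _ _ _ cc x p q r s Ux).
have n2 : (2 < n)%N by exact: leq_trans n4.
have n2R : 2 < n%:R :> R by rewrite (ltr_nat _ 2 n).
have n0 : n%:R != 0 :> R by rewrite gt_eqF // (lt_trans _ n2R).
have nn2 : n%:R - 2 != 0 :> R by rewrite gt_eqF // subr_gt0.
have n10 : n%:R - 1 != 0 :> R.
  by rewrite gt_eqF // subr_gt0 (lt_trans _ n2R) // ltr1n.
have SE i j : shape_mx x i j =
    al / lam x * (i == j)%:R + be / lam x * (e 0 i * e 0 j).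
  by rewrite mxE he dot_bvecs !dot_bvec; field.
have [m t2 t3] := rank_one_invariants n2 e1 SE.
rewrite -/(mean_shape x) in m t2 t3; rewrite -/(tracefree x) in t2 t3.
rewrite -/(tracefree2 x) in t2; rewrite -/(tracefree3 x) in t3.
set b := be / lam x in SE m t2 t3.
have c1 : 1 - n%:R^-1 != 0 :> R.
  rewrite (_ : _ - _ = (n%:R - 1) / n%:R); last by field.
  by rewrite mulf_neq0 // invr_neq0.
have bE : beta_of x = b.
  rewrite /beta_of t2 t3; have [->|b0] := eqVneq b 0.
    by rewrite !expr0n /= !mul0r mulr0.
  have -> : n%:R / (n%:R - 2) * (b ^+ 3 * ((1 - n%:R^-1) * (1 - 2 / n%:R))
    / (b ^+ 2 * (1 - n%:R^-1))) =
    n%:R / (n%:R - 2) * (1 - 2 / n%:R) * b by field; rewrite ?c1 ?n10 ?n0 ?nn2 ?b0.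
  by rewrite (_ : _ * (1 - _) = 1) ?mul1r //; field; rewrite n0 nn2.
have aE : alpha_of x = al / lam x by rewrite /alpha_of m bE addrK.
split; first by rewrite bE t2 [RHS]mulf_eq0 expf_eq0 /= (negbTE c1) orbF.
by exists e => // v w; rewrite he aE bE /b; field.
Qed.

Lemma open_nonzero V (f : 'rV[R]_n -> R) : open V ->
  (forall x, V x -> {for x, continuous f}) -> open (V `&` [set x | f x != 0]).
Proof.
move=> oV cf; rewrite openE => x [Vx fx0]; apply: filterI.
  exact: open_nbhs_nbhs.
exact: (cvgr_neq0 _ (cf x Vx)).
Qed.

Lemma smooth_coefs_nonzero V : open V -> V `<=` U -> nonzero_on V beta_of ->
  smooth_on V alpha_of /\ smooth_on V beta_of.
Proof.
move=> oV VU b0.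
have sb : smooth_on V beta_of.
  apply: smooth_onM => //; first exact: smooth_on_cst.
  apply: smooth_onM => //; first exact: smooth_on_sub VU smooth_tracefree3.
  apply: smooth_onV => //; last exact: smooth_on_sub VU smooth_tracefree2.
  by move=> x Vx; have [<- _] := shape_spec (VU _ Vx); exact: b0.
split=> //; apply: smooth_onB => //; first exact: smooth_on_sub VU smooth_mean.
by apply: smooth_onM => //; exact: smooth_on_cst.
Qed.

Lemma smooth_coefs_zero V : open V -> V `<=` U -> zero_on V beta_of ->
  smooth_on V alpha_of /\ smooth_on V beta_of.
Proof.
move=> oV VU b0; split.
  apply: (smooth_on_ext (f := mean_shape)) => //.
    by move=> x Vx; rewrite /alpha_of b0 // mul0r subr0.
  exact: smooth_on_sub VU smooth_mean.
apply: (smooth_on_ext (f := fun=> 0)) => //; last exact: smooth_on_cst.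
by move=> x Vx; rewrite b0.
Qed.

Lemma open_beta_nonzero V : open V -> V `<=` U ->
  open (V `&` [set x | beta_of x != 0]).
Proof.
move=> oV VU.
have -> : V `&` [set x | beta_of x != 0] = V `&` [set x | tracefree2 x != 0].
  apply/seteqP; split=> x [Vx /= b0]; split=> //=;
    by have [E _] := shape_spec (VU _ Vx); rewrite ?E // -E.
apply: (open_nonzero oV) => x Vx.
exact: smooth_continuous smooth_tracefree2 (VU _ Vx).
Qed.

(** The set where beta has no zero is open.  On an open set where beta has no
    zero, or vanishes identically, alpha is smooth, so that near a given point
    one finds an open set where alpha has no zero unless it vanishes
    identically. *)
Lemma generic_dense : U `<=` closure (generic U alpha_of beta_of).
Proof.
have step V : open V -> V `<=` U -> V !=set0 ->
    zero_on V beta_of \/ nonzero_on V beta_of ->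
    V `&` generic U alpha_of beta_of !=set0.
  move=> oV VU [y Vy] bV.
  have [sa _] : smooth_on V alpha_of /\ smooth_on V beta_of.
    by case: bV; [exact: smooth_coefs_zero|exact: smooth_coefs_nonzero].
  have [[z Vz az]|za] := pselect (exists2 z, V z & alpha_of z != 0).
    exists z; split=> //; exists (V `&` [set x | alpha_of x != 0]); split=> //.
    - by apply: (open_nonzero oV) => x; exact: smooth_continuous sa.
    - by move=> x [/VU].
    - by right=> x [].
    - by case: bV => b0; [left|right] => x [Vx _]; exact: b0.
  exists y; split=> //; exists V; split=> //; left=> x Vx.
  by apply/eqP/negP => a0; apply: za; exists x => //; exact/negP.
move=> x Ux B Bx.
have [V [oV Vx VB VU]] : exists V, [/\ open V, V x, V `<=` B & V `<=` U].
  have [V [oV Vx] VBU] : exists2 V, open_nbhs x V & V `<=` B `&` U.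
    have : nbhs x (B `&` U) by apply: filterI => //; exact: open_nbhs_nbhs.
    by rewrite nbhsE => -[V]; exists V.
  by exists V; split=> // y /VBU[].
suff [z [Vz gz]] : V `&` generic U alpha_of beta_of !=set0.
  by exists z; split=> //; exact: VB.
have [[z Vz bz]|zb] := pselect (exists2 z, V z & beta_of z != 0).
  have oV' := open_beta_nonzero oV VU.
  have [||||t [[Vt _] gt]] := step (V `&` [set x | beta_of x != 0]) => //.
  - by move=> y [/VU].
  - by exists z.
  - by right=> y [].
  - by exists t.
apply: step => //; first by exists x.
left=> y Vy; apply/eqP/negP => b0; apply: zb; exists y => //; exact/negP.
Qed.

Lemma decomposition_of V (e : 'rV[R]_n -> 'rV[R]_n) : V `<=` U ->
  (forall x, V x -> dot (e x) (e x) = 1 /\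
    forall v w, second_form phi nu x v w =
      lam x * (alpha_of x * dot v w + beta_of x * (dot (e x) v * dot (e x) w))) ->
  second_form_decomposition V phi nu alpha_of beta_of
    (fun x => Num.sqrt (lam x) *: e x).
Proof.
move=> VU He x Vx; have Ux := VU _ Vx; have [e1 he] := He _ Vx.
have l0 := cc_pos cc Ux.
set s := Num.sqrt (lam x); have s0 : s != 0 by rewrite gt_eqF // sqrtr_gt0.
have ss : s * s = lam x by rewrite -expr2 sqr_sqrtr // ltW.
have ME v w : metric phi x v w = lam x * dot v w := cc_conf cc Ux v w.
split.
  exists (s^-1 *: e x); split=> [|v].
    by apply: etrans (ME _ _) _; rewrite !dotE e1 -ss; field.
  by rewrite ME !dotE -ss; field.
by move=> v w; apply: etrans (he v w) _; rewrite ME !dotE -ss; ring.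
Qed.

Lemma exists_eta : exists eta,
  second_form_decomposition U phi nu alpha_of beta_of eta.
Proof.
have [e He] : {e : 'rV[R]_n -> 'rV[R]_n & forall x, U x ->
    dot (e x) (e x) = 1 /\ forall v w, second_form phi nu x v w =
      lam x * (alpha_of x * dot v w + beta_of x * (dot (e x) v * dot (e x) w))}.
  apply: (choice (P := fun x e => U x -> dot e e = 1 /\
    forall v w, second_form phi nu x v w =
      lam x * (alpha_of x * dot v w + beta_of x * (dot e v * dot e w)))) => x.
  have [Ux|nUx] := pselect (U x); last by exists 0.
  by have [_ [e e1 he]] := shape_spec Ux; exists e.
by exists (fun x => Num.sqrt (lam x) *: e x); exact: decomposition_of.
Qed.

(** A unit vector e is only determined up to sign, but the matrix
    P = (S - alpha) / beta of e tensor e is smooth.  A column of P divided by the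
    square root of its diagonal entry is a smooth choice of e.  If beta vanishes
    identically, every unit vector will do. *)
Lemma exists_smooth_eta x V : open V -> V `<=` U -> V x ->
  zero_on V beta_of \/ nonzero_on V beta_of ->
  exists V' eta, [/\ open V', V' x, V' `<=` V, smooth_on V' eta
    & second_form_decomposition V' phi nu alpha_of beta_of eta].
Proof.
move=> oV VU Vx.
have sl : smooth_on V (fun x => Num.sqrt (lam x)).
  apply: smooth_on_sqrt => //; last exact: smooth_on_sub VU (cc_lam cc).
  by move=> y /VU; exact: (cc_pos cc).
case=> b0.
  have i0 : 'I_n by apply: (@Ordinal n 0); apply: leq_trans n4.
  exists V, (fun x => Num.sqrt (lam x) *: bvec i0); split=> //.
    by apply: smooth_on_scale => //; exact: smooth_on_cst.
  apply: decomposition_of => // y Vy; rewrite dot_bvecs eqxx; split=> // v w.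
  have [_ [e _ ->]] := shape_spec (VU _ Vy).
  by rewrite b0 // !mul0r.
pose P y i j := (shape_mx y i j - alpha_of y * (i == j)%:R) / beta_of y.
have [sa sb] := smooth_coefs_nonzero oV VU b0.
have sP i j : smooth_on V (fun y => P y i j).
  apply: smooth_onM => //; last exact: smooth_onV.
  apply: smooth_onB => //; first exact: smooth_on_sub VU (smooth_shape i j).
  by apply: smooth_onM => //; exact: smooth_on_cst.
have PE y : V y -> exists2 e : 'rV[R]_n, dot e e = 1 &
    (forall i j, P y i j = e 0 i * e 0 j) /\
    forall v w, second_form phi nu y v w =
      lam y * (alpha_of y * dot v w + beta_of y * (dot e v * dot e w)).
  move=> Vy; have [_ [e e1 he]] := shape_spec (VU _ Vy); exists e => //; split=> // i j.
  rewrite /P mxE he dot_bvecs !dot_bvec; field.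
  by rewrite b0 //= gt_eqF // (cc_pos cc (VU _ Vy)).
have [i Pi] : exists i, P x i i != 0.
  have [e e1 [eP _]] := PE _ Vx; apply/existsP; apply: contra_eqT e1.
  rewrite negb_exists => /forallP e0.
  have -> : dot e e = 0.
    apply: big1 => i _; rewrite -eP; apply/eqP.
    by have := e0 i; rewrite negbK.
  by rewrite eq_sym oner_neq0.
pose V' := V `&` [set y | P y i i != 0].
have oV' : open V'.
  by apply: (open_nonzero oV) => y Vy; exact: smooth_continuous (sP i i) Vy.
have VV : V' `<=` V by move=> y [].
pose k y := (Num.sqrt (P y i i))^-1.
have Pp y : V' y -> 0 < P y i i.
  move=> [Vy P0]; rewrite lt_def P0 /=.
  by have [e _ [-> _]] := PE _ Vy; rewrite -expr2 sqr_ge0.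
pose e y : 'rV[R]_n := k y *: \row_j P y i j.
exists V', (fun y => Num.sqrt (lam y) *: e y); split=> //.
  apply: smooth_on_scale => //; first exact: smooth_on_sub VV sl.
  apply: smooth_on_scale => //.
    apply: smooth_onV => //.
      by move=> y V'y; rewrite gt_eqF // sqrtr_gt0 Pp.
    by apply: smooth_on_sqrt => //; exact: smooth_on_sub VV (sP i i).
  by apply: smooth_row => // j; exact: smooth_on_sub VV (sP i j).
apply: decomposition_of; first by move=> y /VV /VU.
move=> y V'y; have [f f1 [fP hf]] := PE _ (VV _ V'y).
have p0 := Pp _ V'y; rewrite fP in p0.
have kk : k y * k y * (f 0 i * f 0 i) = 1.
  by rewrite /k fP -invfM -expr2 sqr_sqrtr ?mulVf ?gt_eqF // ltW.
have eE v : dot (e y) v = k y * f 0 i * dot f v.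
  rewrite /e dotZl -mulrA; congr (_ * _); rewrite /dot mulr_sumr.
  by apply: eq_bigr => j _; rewrite !mxE fP mulrA.
have ee v w : dot (e y) v * dot (e y) w = dot f v * dot f w.
  by rewrite !eE -[RHS]mul1r -kk; ring.
split; last by move=> v w; rewrite ee hf.
rewrite eE dotC eE f1 mulr1 -[RHS]kk; ring.
Qed.

End SmoothCoefficients.

(** * An implicit function theorem in the plane *)

Section Implicit.
Context {R : realType}.

(** Distances to a are used so that the order of a and b does not matter. *)
Lemma MVT_between (f df : R -> R) (a b : R) :
  (forall x, `|x - a| <= `|b - a| -> is_derive x 1 f (df x)) ->
  exists2 c, `|c - a| <= `|b - a| & f b - f a = df c * (b - a).
Proof.
move=> Df; have [ab|ba] := leP a b.
  have H x : a <= x <= b -> is_derive x 1 f (df x).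
    by move=> /andP[ax xb]; apply: Df; rewrite !ger0_norm ?subr_ge0 // lerD2r.
  have [x xab||c cab E] := @MVT_segment _ f df a b ab.
  - by apply: H; rewrite in_itv /= in xab; case/andP: xab => /ltW -> /ltW ->.
  - apply: derivable_within_continuous => x xab; apply: ex_derive.
    by apply: H; rewrite in_itv /= in xab.
  exists c => //; move: cab; rewrite in_itv /= => /andP[ac cb].
  by rewrite !ger0_norm ?subr_ge0 // lerD2r.
have H x : b <= x <= a -> is_derive x 1 f (df x).
  move=> /andP[bx xa]; apply: Df.
  by rewrite !ler0_norm ?subr_le0 // ?(ltW ba) // lerN2 lerD2r.
have [x xab||c cab E] := @MVT_segment _ f df b a (ltW ba).
- by apply: H; rewrite in_itv /= in xab; case/andP: xab => /ltW -> /ltW ->.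
- apply: derivable_within_continuous => x xab; apply: ex_derive.
  by apply: H; rewrite in_itv /= in xab.
exists c; last by rewrite -opprB E -mulrN opprB.
move: cab; rewrite in_itv /= => /andP[bc ca].
by rewrite !ler0_norm ?subr_le0 // ?(ltW ba) // lerN2 lerD2r.
Qed.

(** The solution T of F r (T r) = c is continuous at r0 because F r is strictly
    increasing.  The mean value theorem in each variable gives
      Ft r y (T r - T r0) + Fr y' (T r0) (r - r0) = 0
    with y no farther from T r0 than T r, and y' no farther from r0 than r;
    divide and let r tend to r0. *)
Lemma implicit_derive (F Fr Ft : R -> R -> R) (T : R -> R) (r0 eps c : R) :
  (\forall r \near r0, forall t : R, `|t| <= eps ->
     [/\ is_derive (r : R) 1 (F ^~ t) (Fr r t), is_derive t 1 (F r) (Ft r t)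
       & 0 < Ft r t]) ->
  {for (r0, T r0), continuous (fun p : R * R => Fr p.1 p.2)} ->
  {for (r0, T r0), continuous (fun p : R * R => Ft p.1 p.2)} ->
  (\forall r \near r0, `|T r| < eps /\ F r (T r) = c) ->
  is_derive r0 1 T (- Fr r0 (T r0) / Ft r0 (T r0)).
Proof.
move=> DF cFr cFt TF; set t0 := T r0.
have DF0 := nbhs_singleton DF.
have [t0e Fc] : `|t0| < eps /\ F r0 t0 = c := nbhs_singleton TF.
have t0l : `|t0| <= eps by exact: ltW.
pose good (r : R) := forall t : R, `|t| <= eps ->
     [/\ is_derive r 1 (F ^~ t) (Fr r t), is_derive t 1 (F r) (Ft r t)
       & 0 < Ft r t].
have mono r : good r -> forall a b, - eps <= a -> a < b -> b <= eps -> F r a < F r b.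
  move=> Dr a b ea ab be; rewrite -subr_gt0.
  have H x : a <= x <= b -> is_derive x 1 (F r) (Ft r x).
    move=> /andP[ax xb]; have [] // := Dr x _.
    by rewrite ler_norml; apply/andP; split; lra.
  have [x xab||d dab ->] := @MVT_segment _ (F r) (Ft r) a b (ltW ab).
  - by apply: H; rewrite in_itv /= in xab; case/andP: xab => /ltW -> /ltW ->.
  - apply: derivable_within_continuous => x xab; apply: ex_derive.
    by apply: H; rewrite in_itv /= in xab.
  rewrite mulr_gt0 ?subr_gt0 //; rewrite in_itv /= in dab.
  by have [] // := Dr d _; rewrite ler_norml; case/andP: dab => ? ?; apply/andP; split; lra.
have contF t : `|t| <= eps -> {for r0, continuous (F ^~ t)}.
  move=> /DF0[d _ _]; apply: differentiable_continuous.
  exact/derivable1_diffP.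
have Tc e : 0 < e -> \forall r \near r0, `|T r - t0| < e.
  move=> e0; move: (t0e); rewrite ltr_norml => /andP[tl tr].
  pose h := Num.min e (Num.min (eps - t0) (t0 + eps)) / 2.
  have h0 : 0 < h.
    rewrite divr_gt0 // !lt_min e0 /=. by apply/andP; split; lra.
  have [he h1 h2] : [/\ h < e, h < eps - t0 & h < t0 + eps].
    have hm : h < Num.min e (Num.min (eps - t0) (t0 + eps)).
      by rewrite /h ltr_pdivrMr // ltr_pMr ?ltr1n // -[X in _ < X](mulfVK (_ : 2 != 0)) // mulr_gt0.
    by move: hm; rewrite !lt_min => /and3P[].
  have lo : F r0 (t0 - h) < c by rewrite -Fc; apply: (mono _ DF0); lra.
  have hi : c < F r0 (t0 + h) by rewrite -Fc; apply: (mono _ DF0); lra.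
  have nlo : \forall r \near r0, F r (t0 - h) < c.
    apply: (cvgr_lt _ (contF (t0 - h) _)) => //.
    by rewrite ler_norml; apply/andP; split; lra.
  have nhi : \forall r \near r0, c < F r (t0 + h).
    apply: (cvgr_gt _ (contF (t0 + h) _)) => //.
    by rewrite ler_norml; apply/andP; split; lra.
  near=> r.
  have Dr : good r by near: r; exact: DF.
  have [Te TE] : `|T r| < eps /\ F r (T r) = c by near: r; exact: TF.
  have l : F r (t0 - h) < c by near: r; exact: nlo.
  have u : c < F r (t0 + h) by near: r; exact: nhi.
  move: Te; rewrite ltr_norml => /andP[Tl Tr].
  rewrite -TE in l u.
  have l' : t0 - h < T r.
    rewrite ltNge; apply/negP; rewrite le_eqVlt => /orP[/eqP E|lt].
      by rewrite E ltxx in l.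
    by have := mono _ Dr _ _ (ltW Tl) lt _; rewrite ltNge (ltW l) => /(_ _)/negP; apply; lra.
  have u' : T r < t0 + h.
    rewrite ltNge; apply/negP; rewrite le_eqVlt => /orP[/eqP E|lt].
      by rewrite E ltxx in u.
    have : F r (t0 + h) < F r (T r) by apply: (mono _ Dr) => //; lra.
    by rewrite ltNge (ltW u).
  by rewrite ltr_norml; apply/andP; split; lra.
set L := - Fr r0 t0 / Ft r0 t0.
have B0 : 0 < Ft r0 t0 by have [] := DF0 t0 t0l.
have Q e : 0 < e -> exists2 d, 0 < d & forall a b a' b',
   `|a - r0| < d -> `|b - t0| < d -> `|a' - r0| < d -> `|b' - t0| < d ->
   `|L - (- Fr a b / Ft a' b')| < e.
  move=> e0.
  have c1 : {for ((r0, t0), (r0, t0)),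
      continuous (fun q : (R * R) * (R * R) => Fr q.1.1 q.1.2)}.
    apply: (@continuous_comp _ _ _ fst (fun p : R * R => Fr p.1 p.2)).
      exact: cvg_fst.
    exact: cFr.
  have c2 : {for ((r0, t0), (r0, t0)),
      continuous (fun q : (R * R) * (R * R) => Ft q.2.1 q.2.2)}.
    apply: (@continuous_comp _ _ _ snd (fun p : R * R => Ft p.1 p.2)).
      exact: cvg_snd.
    exact: cFt.
  have cL : (fun q : (R * R) * (R * R) => - Fr q.1.1 q.1.2 / Ft q.2.1 q.2.2) q
      @[q --> ((r0, t0), (r0, t0))] --> L.
    by apply: cvgM; [exact: cvgN|apply: cvgV => //; rewrite gt_eqF].
  have /cvgrPdist_lt/(_ _ e0)/nbhs_ballP[d /= d0 H] := cL.
  exists d => // a b a' b' ar bt ar' bt'.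
  by apply: (H ((a, b), (a', b'))); split; split; rewrite /= -ball_normE /= distrC.
apply/is_derive1_caratheodory.
exists (fun z => if z == r0 then L else (T z - t0) / (z - r0)); split.
- move=> z; case: eqP => [->|/eqP zr]; first by rewrite !subrr mulr0.
  by rewrite divfK // subr_eq0.
- rewrite /prop_for /continuous_at eqxx; apply/cvgrPdist_lt => e e0.
  have [d d0 Qd] := Q _ e0.
  have /nbhs_ballP[d1 /= d10 DF1] := DF.
  have nz (d' : R) : 0 < d' -> \forall z \near r0, `|z - r0| < d'.
    move=> d'0; apply/nbhs_ballP; exists d' => // z.
    by rewrite -ball_normE /= distrC.
  have et0 : 0 < eps - `|t0| by rewrite subr_gt0.
  near=> z; case: eqP => [_|/eqP zr]; first by rewrite subrr normr0.
  have Dz : good z by near: z; exact: DF.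
  have zd : `|z - r0| < d by near: z; exact: nz.
  have zd1 : `|z - r0| < d1 by near: z; exact: nz.
  have Td : `|T z - t0| < d by near: z; exact: Tc.
  have Te : `|T z - t0| < eps - `|t0| by near: z; exact: Tc.
  have Fz : F z (T z) = c by have [] : `|T z| < eps /\ F z (T z) = c by near: z; exact: TF.
  have [x xT|y yT Ey] := @MVT_between (F z) (Ft z) t0 (T z).
    have [] // := Dz x _; rewrite -(subrK t0 x).
    apply: le_trans (ler_normD _ _) _; lra.
  have [x xz|y' y'z Ey'] := @MVT_between (F ^~ t0) (Fr ^~ t0) r0 z.
    have [] // := DF1 x _ t0 t0l.
    by rewrite -ball_normE /= distrC; exact: le_lt_trans zd1.
  have Ft0 : Ft z y != 0.
    have [] // := Dz y _; last by move=> _ _ /gt_eqF ->.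
    rewrite -(subrK t0 y); apply: le_trans (ler_normD _ _) _; lra.
  have -> : (T z - t0) / (z - r0) = - Fr y' t0 / Ft z y.
    have E : Ft z y * (T z - t0) + Fr y' t0 * (z - r0) = 0.
      by rewrite -Ey -Ey' Fz -Fc; ring.
    have zr0 : z - r0 != 0 by rewrite subr_eq0.
    apply: (mulIf zr0); rewrite divfK //; apply: (mulfI Ft0).
    rewrite (_ : Ft z y * (_ / _ * _) = - (Fr y' t0 * (z - r0))); last by field.
    by apply/eqP; rewrite -addr_eq0 E.
  apply: Qd => //; rewrite ?subrr ?normr0 //.
  + exact: le_lt_trans zd.
  + exact: le_lt_trans Td.
- by rewrite eqxx.
Unshelve. all: by end_near. Qed.

End Implicit.

(** * Level sets of a submersion *)

Section LevelSets.
Context {R : realType} {V : normedModType R}.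

Lemma nbhs_norm (W : normedModType R) (x : W) (d : R) : 0 < d ->
  \forall y \near x, `|y - x| < d.
Proof.
move=> d0; apply/nbhs_ballP; exists d => // y.
by rewrite -ball_normE /= distrC.
Qed.

Lemma is_derive_line (f : V -> R) (x w : V) (r : R) :
  differentiable f (x + r *: w) ->
  is_derive r 1 (fun r => f (x + r *: w)) ('D_w f (x + r *: w)).
Proof.
move=> df; have [d D] := line_diff df.
by split; [exact: diff_derivable|rewrite D scale1r].
Qed.

Lemma is_derive_path (f : V -> R) (x w u : V) (T : R -> R) (r T' : R) :
  is_derive r 1 T T' -> differentiable f (x + r *: w + T r *: u) ->
  is_derive r 1 (fun r => f (x + r *: w + T r *: u))
    ('D_w f (x + r *: w + T r *: u) + T' * 'D_u f (x + r *: w + T r *: u)).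
Proof.
move=> DT df; pose P (r : R) := x + r *: w + T r *: u.
have dT : differentiable T r by apply/derivable1_diffP.
have [d1 D1] := scale_fun_diff dT (differentiable_cst u r).
have did : differentiable (id : R -> R) r by [].
have [d2 D2] := scale_fun_diff did (differentiable_cst w r).
have d3 := differentiableD (differentiable_cst x r) d2.
have dP : differentiable P r := differentiableD d3 d1.
have DP : 'D_1 P r = w + T' *: u.
  apply: etrans (deriveD (diff_derivable d3) (diff_derivable d1)) _.
  rewrite D1; apply: etrans (congr1 (+%R ^~ _)
    (deriveD (derivable_cst x r 1) (diff_derivable d2))) _.
  by rewrite D2 !derive_cst !scaler0 !addr0 add0r derive_id scale1r derive_val.
have dfP : differentiable (f \o P) r by exact: differentiable_comp.
split; first exact: (diff_derivable dfP).
rewrite -[LHS]/('D_1 (f \o P) r) deriveE // diff_comp //=.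
by rewrite -(deriveE _ dP) DP linearD linearZ /= !deriveE.
Qed.

Lemma quot_cancel (a b c d : R) : d != 0 -> a * d = b * c -> a + - c / d * b = 0.
Proof.
move=> d0 E; apply: (mulIf d0); rewrite mul0r mulrDl E; field.
exact: d0.
Qed.

(** The set B consists of points x0 + w + t u with w and t small.  On the lines
    of direction u near x0 the function sigma is strictly increasing and takes
    all values in J.  Given x = x0 + w + t u in B and s = sigma x, the points of
    level s on the lines through x0 + r w, for r in [0, 1], form a curve from
    x0 + tau(s) u to x, differentiable by [implicit_derive].  Since sigma is
    constant along it, so is f, whose differential is proportional to that of
    sigma. *)
Lemma level_box (U : set V) (sigma : V -> R) (x0 u : V) :
  open U -> U x0 -> smooth_on U sigma -> 0 < 'D_u sigma x0 ->
  exists (B : set V) (J : set R) (tau : R -> R),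
  [/\ [/\ open B, B x0 & B `<=` U],
      [/\ open J, is_interval J & sigma @` B = J],
      (forall x, B x -> 'D_u sigma x != 0),
      smooth_on J tau /\
        (forall s, J s -> B (x0 + tau s *: u) /\ sigma (x0 + tau s *: u) = s)
    & forall f : V -> R, smooth_on U f ->
        (forall x w, U x -> 'D_w f x * 'D_u sigma x = 'D_u f x * 'D_w sigma x) ->
        forall x, B x -> f x = f (x0 + tau (sigma x) *: u)].
Proof.
move=> oU Ux0 ssig D0.
have cont x : U x -> {for x, continuous sigma} by exact: smooth_continuous.
have dsig x : U x -> differentiable sigma x by exact: smooth_differentiable.
have sD w := smooth_derive w ssig.
have [rho rho0 Hrho] : exists2 rho, 0 < rho & forall x, `|x - x0| < rho ->
    U x /\ 0 < 'D_u sigma x.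
  have n1 : \forall x \near x0, U x by exact: open_nbhs_nbhs.
  have n2 : \forall x \near x0, 0 < 'D_u sigma x.
    exact: (cvgr_gt _ (smooth_continuous (sD u) Ux0)).
  have n3 : \forall x \near x0, U x /\ 0 < 'D_u sigma x by exact: filterI.
  move: n3 => /nbhs_ballP[rho /= rho0 H].
  by exists rho => // x xr; apply: H; rewrite -ball_normE /= distrC.
pose k := `|u| + 1; have k0 : 0 < k by rewrite ltr_wpDl.
pose eps := rho / 2 / k; have eps0 : 0 < eps by rewrite !divr_gt0.
have epsu t : `|t| <= eps -> `|t *: u| < rho / 2.
  move=> te; rewrite normrZ.
  apply: (@le_lt_trans _ _ (eps * `|u|)); first exact: ler_wpM2r.
  by rewrite -[ltRHS](divfK (lt0r_neq0 k0)) ltr_pM2l // ltrDl.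
have inb w t : `|w| < rho / 2 -> `|t| <= eps ->
    U (x0 + w + t *: u) /\ 0 < 'D_u sigma (x0 + w + t *: u).
  move=> wr /epsu tr; apply: Hrho; rewrite -[x0 + w + _]addrA [x0 + _]addrC addrK.
  apply: le_lt_trans (ler_normD _ _) _; rewrite [ltRHS](splitr rho).
  exact: ltrD.
have mono w a b : `|w| < rho / 2 -> - eps <= a -> a < b -> b <= eps ->
    sigma (x0 + w + a *: u) < sigma (x0 + w + b *: u).
  move=> wr ea ab be.
  have le t : a <= t <= b -> `|t| <= eps.
    by move=> /andP[at' tb]; rewrite ler_norml (le_trans ea) //= (le_trans tb).
  have [t tab|c cab E] := @line_MVT _ _ sigma (x0 + w) u a b (ltW ab).
    by apply: dsig; have [] := inb _ _ wr (le _ tab).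
  rewrite -subr_gt0 E mulr_gt0 ?subr_gt0 //.
  by have [] := inb _ _ wr (le _ cab).
set s0 := sigma x0.
have w0 : `|0 : V| < rho / 2 by rewrite normr0 divr_gt0.
have s0E : s0 = sigma (x0 + 0 + 0 *: u) by rewrite scale0r !addr0.
have lo : sigma (x0 + 0 + (- eps) *: u) < s0.
  by rewrite s0E; apply: mono => //; rewrite ?oppr_lt0 // ltW.
have hi : s0 < sigma (x0 + 0 + eps *: u).
  by rewrite s0E; apply: mono => //; rewrite oppr_le0 ltW.
(* At the two ends of the segment sigma differs from s0 by at least 2 kap; a
   translation of norm less than del changes these values by less than kap, so
   that they stay outside J. *)
pose kap := Num.min (sigma (x0 + 0 + eps *: u) - s0)
  (s0 - sigma (x0 + 0 + (- eps) *: u)) / 2.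
have kap0 : 0 < kap by rewrite divr_gt0 // lt_min !subr_gt0 lo hi.
have [kap1 kap2] : kap * 2 <= sigma (x0 + 0 + eps *: u) - s0 /\
    kap * 2 <= s0 - sigma (x0 + 0 + (- eps) *: u).
  by rewrite /kap divfK // !ge_min !lexx orbT.
have near_shift_sigma t : `|t| <= eps -> exists2 d, 0 < d & forall w, `|w| < d ->
    `|sigma (x0 + 0 + t *: u) - sigma (x0 + w + t *: u)| < kap.
  move=> te; have [Ut _] := inb _ _ w0 te.
  have /cvgrPdist_lt/(_ _ kap0)/nbhs_ballP[d /= d0 H] := cont _ Ut.
  exists d => // w wd; apply: H; rewrite -ball_normE /= addr0.
  by rewrite opprD addrACA subrr addr0 opprD addNKr normrN.
have [|d1 d10 Hd1] := near_shift_sigma eps; first by rewrite ger0_norm // ltW.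
have [|d2 d20 Hd2] := near_shift_sigma (- eps).
  by rewrite normrN ger0_norm // ltW.
pose del := Num.min (rho / 2) (Num.min d1 d2).
have del0 : 0 < del by rewrite !lt_min d10 d20 divr_gt0.
have delP w : `|w| < del -> [/\ `|w| < rho / 2,
    s0 + kap < sigma (x0 + w + eps *: u) &
    sigma (x0 + w + (- eps) *: u) < s0 - kap].
  rewrite !lt_min => /and3P[wr /Hd1 h1 /Hd2 h2]; split=> //.
    by move: h1; rewrite ltr_norml => /andP[_ h1]; clear - h1 kap1; lra.
  by move: h2; rewrite ltr_norml => /andP[h2 _]; clear - h2 kap2; lra.
pose J : set R := [set s | `|s - s0| < kap].
have Js0 : J s0 by rewrite /J /= subrr normr0.
have oJ : open J.
  have -> : J = ball s0 kap.
    by apply/seteqP; split=> s; rewrite /J /= -ball_normE /= distrC.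
  exact: ball_open.
have iJ : is_interval J.
  move=> a b; rewrite /J /= !ltr_norml => /andP[a1 _] /andP[_ b2] z /andP[az zb].
  by rewrite ltr_norml; apply/andP; split; [clear - a1 az|clear - b2 zb]; lra.
have solve w s : `|w| < del -> J s ->
    exists t, `|t| < eps /\ sigma (x0 + w + t *: u) = s.
  move=> /delP[wr h1 h2]; rewrite /J /= ltr_norml => /andP[s1 s2].
  have cw : {within `[- eps, eps], continuous (fun t => sigma (x0 + w + t *: u))}.
    apply: derivable_within_continuous => t; rewrite in_itv /= => te.
    have [|Ut _] := inb _ t wr; first by rewrite ler_norml.
    by have [d _] := line_diff (dsig _ Ut); exact: diff_derivable.
  have ee : - eps <= eps by rewrite ge0_cp // ltW.
  have [|t te E] := @IVT R _ (- eps) eps s ee cw.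
    by rewrite ge_min le_max; apply/andP; split; apply/orP; [left|right];
      [clear - h2 s1|clear - h1 s2]; lra.
  exists t; split=> //; move: te; rewrite in_itv /= => /andP[t1 t2].
  rewrite ltr_norml !lt_neqAle t1 t2 !andbT; apply/andP; split; apply/eqP => tE.
    by move: h2; rewrite tE E => h2; clear - h2 s1; lra.
  by move: h1; rewrite -tE E => h1; clear - h1 s2; lra.
(* The parameter at which the line through x0 + w meets the level s. *)
pose T w s := xget 0 [set t : R | `|t| < eps /\ sigma (x0 + w + t *: u) = s].
have TP w s : `|w| < del -> J s ->
    `|T w s| < eps /\ sigma (x0 + w + T w s *: u) = s.
  move=> wd Js; have [t tP] := solve w s wd Js.
  exact: (@xgetPex _ 0 [set t : R | `|t| < eps /\ sigma (x0 + w + t *: u) = s] (ex_intro _ t tP)).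
have uniqT w a b : `|w| < del -> `|a| < eps -> `|b| < eps ->
    sigma (x0 + w + a *: u) = sigma (x0 + w + b *: u) -> a = b.
  move=> /delP[wr _ _]; rewrite !ltr_norml => /andP[a1 a2] /andP[b1 b2] E.
  have [ab|ba|//] := ltgtP a b.
    by have := mono w a b wr (ltW a1) ab (ltW b2); rewrite E ltxx.
  by have := mono w b a wr (ltW b1) ba (ltW a2); rewrite E ltxx.
pose B := [set x | exists t : R, [/\ `|t| < eps, `|x - t *: u - x0| < del & J (sigma x)]].
have BE x : B x -> exists w t, [/\ `|w| < del, `|t| < eps, J (sigma x) & x = x0 + w + t *: u].
  move=> [t [te xd Jx]]; exists (x - t *: u - x0), t; split=> //.
  by rewrite [x0 + _]addrC !subrK.
have BI w t : `|w| < del -> `|t| < eps -> J (sigma (x0 + w + t *: u)) -> B (x0 + w + t *: u).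
  move=> wd te Jx; exists t; split=> //.
  by rewrite addrK [x0 + w]addrC addrK.
have BU x : B x -> U x /\ 0 < 'D_u sigma x.
  move=> /BE[w [t [/delP[wr _ _] te _ ->]]]; exact: inb (ltW te).
have z0 : `|0 : V| < del by rewrite normr0.
have oB : open B.
  rewrite openE => x Bx; have [Ux _] := BU _ Bx; move: Bx => [t [te xd Jx]].
  have n1 : \forall y \near x, J (sigma y).
    by apply: (cont _ Ux); exact: open_nbhs_nbhs.
  have n2 : \forall y \near x, `|y - x| < del - `|x - t *: u - x0|.
    by apply: nbhs_norm; rewrite subr_gt0.
  apply: filterS2 n1 n2 => y Jy yx; exists t; split=> //.
  have -> : y - t *: u - x0 = (y - x) + (x - t *: u - x0) by rewrite !addrA subrK.
  apply: le_lt_trans (ler_normD _ _) _.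
  by rewrite -ltrBrDr.
have tauP s : J s -> `|T 0 s| < eps /\ sigma (x0 + T 0 s *: u) = s.
  by move=> /(TP 0 s z0); rewrite addr0.
have tauB s : J s -> B (x0 + T 0 s *: u).
  move=> Js; have [te E] := tauP _ Js.
  by rewrite -[x0]addr0; apply: BI => //; rewrite addr0 E.
pose I : set R := [set t | `|t| < eps].
have oI : open I.
  have -> : I = ball 0 eps.
    by apply/seteqP; split=> s; rewrite /I /= -ball_normE /= sub0r normrN.
  exact: ball_open.
have IU t : I t -> U (x0 + t *: u) /\ 0 < 'D_u sigma (x0 + t *: u).
  by move=> It; rewrite -[x0]addr0; apply: inb => //; exact: ltW.
have Dtau s : J s -> is_derive s 1 (T 0) (('D_u sigma (x0 + T 0 s *: u))^-1).
  move=> Js.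
  have nJ : \forall s' \near s, J s' by exact: open_nbhs_nbhs.
  have [Ts Es] := tauP _ Js.
  have [Us Ds] := IU _ Ts.
  have -> : ('D_u sigma (x0 + T 0 s *: u))^-1 =
      - (-1) / 'D_u sigma (x0 + T 0 s *: u) by rewrite opprK mul1r.
  apply: (@implicit_derive R (fun s' t => sigma (x0 + t *: u) - s')
    (fun _ _ => -1) (fun _ t => 'D_u sigma (x0 + t *: u)) (T 0) s eps 0).
  - apply: filterS nJ => s' _ t te.
    have [Ut Dt] : U (x0 + t *: u) /\ 0 < 'D_u sigma (x0 + t *: u).
      by rewrite -[x0]addr0; exact: inb.
    split=> //.
      have H : is_derive (s' : R) (1 : R) (cst (sigma (x0 + t *: u)) - id) (0 - 1).
        exact: is_deriveB.
      by rewrite sub0r in H.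
    have H : is_derive t (1 : R) ((fun t => sigma (x0 + t *: u)) - cst s')
        ('D_u sigma (x0 + t *: u) - 0).
      by apply: is_deriveB; apply: is_derive_line; exact: dsig.
    by rewrite subr0 in H.
  - exact: cst_continuous.
  - apply: (@continuous_comp _ _ _ snd (fun t : R => 'D_u sigma (x0 + t *: u))).
      exact: cvg_snd.
    apply: (@continuous_comp _ _ _ (fun t : R => x0 + t *: u) ('D_u sigma)).
      by apply: continuousD; [exact: cst_continuous|exact: scalel_continuous].
    exact: smooth_continuous (sD u) Us.
  - by apply: filterS nJ => s' /tauP[Ts' ->]; rewrite subrr.
have stau : smooth_on J (T 0).
  apply: (smooth_on_ode (g := fun s => ('D_u sigma (x0 + T 0 s *: u))^-1)) => //.
  - by move=> s Js; have := Dtau _ Js => ?; apply/derivable1_diffP.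
  - by move=> s Js; have := Dtau _ Js => ?; exact: derive_val.
  - move=> m Cm.
    apply: (@Ck_on_comp R _ _ m J I (fun t : R => ('D_u sigma (x0 + t *: u))^-1)) => //.
      by move=> s /tauP[].
    apply: smooth_onV => //; first by move=> t /IU[_ /lt0r_neq0].
    exact: (@smooth_on_line _ _ _ U I ('D_u sigma) x0 u oI
      (fun t It => (IU t It).1) (sD u)).
exists B, J, (T 0); split.
- split=> //; last by move=> x /BU[].
  by rewrite -[x0]addr0 -(scale0r u) -[x0]addr0; apply: BI;
    rewrite ?normr0 // scale0r !addr0.
- split=> //; apply/seteqP; split=> [_ [x [t [_ _ Jx]] <-] //|s Js].
  exists (x0 + T 0 s *: u); first exact: tauB.
  by have [] := tauP _ Js.
- by move=> x /BU[_ /lt0r_neq0].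
- by split=> // s Js; split; [exact: tauB|have [] := tauP _ Js].
move=> f sf ker x Bx; have [w [t1 [wd t1e Jx xE]]] := BE _ Bx.
set s := sigma x in Jx *.
have rw (r : R) : `|r| <= 1 -> `|r *: w| < del.
  by move=> r1; rewrite normrZ; apply: le_lt_trans wd; rewrite ler_piMl.
pose P (r : R) := x0 + r *: w + T (r *: w) s *: u.
(* P is the curve of level s from x0 + tau(s) u to x. *)
have DP (r : R) : `|r| <= 1 -> is_derive r (1 : R) (f \o P) 0.
  move=> r1; have [Tr Er] := TP _ _ (rw _ r1) Jx.
  have [UP DuP] : U (P r) /\ 0 < 'D_u sigma (P r).
    by apply: inb (ltW Tr); have [] := delP _ (rw _ r1).
  have nr : \forall r' \near r, `|r' *: w| < del.
    have c : {for r, continuous (fun r' : R => `|r' *: w|)}.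
      apply: (@continuous_comp _ _ _ (fun r' : R => r' *: w) (fun y : V => `|y|)).
        exact: scalel_continuous.
      exact: norm_continuous.
    exact: (cvgr_lt _ c _ (rw _ r1)).
  have DT : is_derive r (1 : R) (fun r' => T (r' *: w) s)
      (- 'D_w sigma (P r) / 'D_u sigma (P r)).
    apply: (@implicit_derive R (fun r' t => sigma (x0 + r' *: w + t *: u))
      (fun r' t => 'D_w sigma (x0 + r' *: w + t *: u))
      (fun r' t => 'D_u sigma (x0 + r' *: w + t *: u)) _ r eps s).
    - apply: filterS nr => r' r'd t te.
      have [Ut Dt] : U (x0 + r' *: w + t *: u) /\
          0 < 'D_u sigma (x0 + r' *: w + t *: u).
        by apply: inb te; have [] := delP _ r'd.
      split=> //; last by apply: is_derive_line; exact: dsig.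
      rewrite addrAC in Ut *.
      rewrite (_ : (fun r'' => _) = fun r'' => sigma (x0 + t *: u + r'' *: w)).
        by apply: is_derive_line; exact: dsig.
      by rewrite funeqE => r''; rewrite addrAC.
    - apply: (@continuous_comp _ _ _ (fun p : R * R => x0 + p.1 *: w + p.2 *: u)
        ('D_w sigma)); last exact: smooth_continuous (sD w) UP.
      apply: continuousD; first apply: continuousD; first exact: cst_continuous.
        apply: (@continuous_comp _ _ _ fst (fun t : R => t *: w)).
          exact: cvg_fst.
        exact: scalel_continuous.
      apply: (@continuous_comp _ _ _ snd (fun t : R => t *: u)).
        exact: cvg_snd.
      exact: scalel_continuous.
    - apply: (@continuous_comp _ _ _ (fun p : R * R => x0 + p.1 *: w + p.2 *: u)
        ('D_u sigma)); last exact: smooth_continuous (sD u) UP.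
      apply: continuousD; first apply: continuousD; first exact: cst_continuous.
        apply: (@continuous_comp _ _ _ fst (fun t : R => t *: w)).
          exact: cvg_fst.
        exact: scalel_continuous.
      apply: (@continuous_comp _ _ _ snd (fun t : R => t *: u)).
        exact: cvg_snd.
      exact: scalel_continuous.
    - by apply: filterS nr => r' r'd; exact: TP.
  apply: is_derive_eq (is_derive_path DT (smooth_differentiable sf UP)) _.
  exact: quot_cancel (lt0r_neq0 DuP) (ker _ w UP).
have [r|c _] := @MVT_between R (f \o P) (fun=> 0) 0 1.
  by rewrite !subr0 normr1; exact: DP.
rewrite mul0r => /eqP; rewrite subr_eq0 => /eqP /=; rewrite /P scale1r scale0r addr0.
have <- : t1 = T w s.
  have [Tw Ew] := TP _ _ wd Jx.
  by apply: (uniqT w) => //; rewrite Ew -xE.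
by rewrite -xE.
Qed.

End LevelSets.

(** * Maps whose differential has rank one *)

Section Foliation.
Context {R : realType} {n : nat}.

Lemma row_free_pair m (u w : 'rV[R]_m) :
  (forall p q : R, p *: u + q *: w = 0 -> p = 0 /\ q = 0) ->
  row_free (col_mx u w).
Proof.
move=> H; apply: inj_row_free => v.
rewrite -[v]hsubmxK mul_row_col.
rewrite [lsubmx v]mx11_scalar [rsubmx v]mx11_scalar !mul_scalar_mx => /H[-> ->].
by rewrite !raddf0 row_mx0.
Qed.

(** v - ((e, v) / (e, u)) u lies in the kernel of e. *)
Lemma kernel_ratio (W : normedModType R) (f : 'rV[R]_n -> W) (e : 'rV[R]_n) x u v :
  differentiable f x -> (forall w, dot e w = 0 -> 'D_w f x = 0) -> dot e u != 0 ->
  'D_v f x = (dot e v / dot e u) *: 'D_u f x.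
Proof.
move=> df ker eu; set k := dot e v / dot e u.
have : 'D_(v + (- k) *: u) f x = 0.
  by apply: ker; rewrite !dotE /k; field.
rewrite derive_dirD // derive_dirZ // scaleNr => /eqP.
by rewrite subr_eq0 => /eqP.
Qed.

Lemma factor_derive (W : normedModType R) (B : set 'rV[R]_n)
    (f : 'rV[R]_n -> W) (a : R -> W) (sigma : 'rV[R]_n -> R) y u :
  open B -> B y -> (forall x, B x -> f x = a (sigma x)) ->
  differentiable sigma y -> differentiable a (sigma y) ->
  'D_u f y = 'D_u sigma y *: 'D_1 a (sigma y).
Proof.
move=> oB By fa ds da; have [_ <-] := comp_real_diff ds da.
apply: near_eq_derive; apply: filterS fa _; exact: open_nbhs_nbhs.
Qed.

(** For sigma take a coordinate of F with nonzero differential at x0.  Near x0 its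
    differential has the same kernel as eta, so the differential of every f as
    below is proportional to it and [level_box] applies.  The functions a are
    the restrictions of f to the line through x0 that [level_box] provides. *)
Lemma foliation (m : nat) (V : set 'rV[R]_n) (eta : 'rV[R]_n -> 'rV[R]_n)
    (F : 'rV[R]_n -> 'rV[R]_m) x0 v0 :
  open V -> V x0 -> smooth_on V F ->
  (forall x w, V x -> dot (eta x) w = 0 -> 'D_w F x = 0) ->
  'D_v0 F x0 != 0 ->
  exists (B : set 'rV[R]_n) (J : set R) (sigma : 'rV[R]_n -> R) (u : 'rV[R]_n),
  [/\ [/\ open B, B x0 & B `<=` V], one_parameter_foliation B J sigma,
      forall x, B x -> 'D_u sigma x != 0 /\ dot (eta x) u != 0,
      forall k (f : 'rV[R]_n -> 'rV[R]_k), smooth_on V f ->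
        (forall x w, V x -> dot (eta x) w = 0 -> 'D_w f x = 0) ->
        exists a, smooth_on J a /\ forall x, B x -> f x = a (sigma x)
    & forall f : 'rV[R]_n -> R, smooth_on V f ->
        (forall x w, V x -> dot (eta x) w = 0 -> 'D_w f x = 0) ->
        exists a, smooth_on J a /\ forall x, B x -> f x = a (sigma x)].
Proof.
move=> oV Vx0 sF ker Fv0.
have [k Fk] : exists k, 'D_v0 F x0 0 k != 0.
  apply/existsP; apply: contraR Fv0; rewrite negb_exists => /forallP F0.
  by apply/eqP/rowP => k; rewrite mxE; apply/eqP; have := F0 k; rewrite negbK.
pose sigma x := F x 0 k.
have ssig : smooth_on V sigma by exact: smooth_coord.
have DsE x w : V x -> 'D_w sigma x = 'D_w F x 0 k.
  by move=> Vx; have [_ ->] := coord_diff k (smooth_differentiable sF Vx).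
have kers x w : V x -> dot (eta x) w = 0 -> 'D_w sigma x = 0.
  by move=> Vx ew; rewrite DsE // ker // mxE.
have [u u0] : exists u, 0 < 'D_u sigma x0.
  have D0 : 'D_v0 sigma x0 != 0 by rewrite DsE.
  have ds := smooth_differentiable ssig Vx0.
  have [|D0'|/esym/eqP] := ltgtP 0 ('D_v0 sigma x0); first by exists v0.
    exists ((-1) *: v0); rewrite derive_dirZ //.
    by rewrite scaleN1r oppr_gt0.
  by rewrite (negbTE D0).
(* There the differential of sigma has exactly the kernel of eta as kernel. *)
pose V0 := V `&` [set x | 'D_u sigma x != 0].
have oV0 : open V0.
  apply: (open_nonzero oV) => x Vx.
  exact: smooth_continuous (smooth_derive u ssig) Vx.
have V0V : V0 `<=` V by move=> x [].
have V0x0 : V0 x0 by split=> //; exact: lt0r_neq0.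
have eu x : V0 x -> dot (eta x) u != 0.
  by move=> [Vx /eqP Du]; apply/eqP => eu; apply: Du; exact: kers.
have [B [J [tau [[oB Bx0 BV] [oJ iJ sB] DB [stau tauB] fac]]]] :=
  level_box oV0 V0x0 (smooth_on_sub V0V ssig) u0.
have facR (f : 'rV[R]_n -> R) : smooth_on V f ->
    (forall x w, V x -> dot (eta x) w = 0 -> 'D_w f x = 0) ->
    forall x, B x -> f x = f (x0 + tau (sigma x) *: u).
  move=> sf kerf x Bx.
  apply: (fac f (smooth_on_sub V0V sf)) => // y w V0y; have Vy := V0V _ V0y.
  have df := smooth_differentiable sf Vy.
  have ds := smooth_differentiable ssig Vy.
  have E1 := kernel_ratio w df (fun w => kerf y w Vy) (eu _ V0y).
  have E2 := kernel_ratio w ds (fun w => kers y w Vy) (eu _ V0y).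
  have alg (a b c d q : R) : a = q * b -> c = q * d -> a * d = b * c.
    by move=> -> ->; ring.
  exact: alg E1 E2.
have smth (W : normedModType R) (f : 'rV[R]_n -> W) : smooth_on V f ->
    smooth_on J (fun s => f (x0 + tau s *: u)).
  move=> sf.
  pose I : set R := [set t | V0 (x0 + t *: u)].
  have oI : open I.
    rewrite openE => t It; rewrite /I /interior /=.
    have c : {for t, continuous (fun t : R => x0 + t *: u)}.
      by apply: continuousD; [exact: cst_continuous|exact: scalel_continuous].
    by apply: (c V0); exact: open_nbhs_nbhs.
  apply: (@smooth_on_comp _ _ _ J I (fun t => f (x0 + t *: u)) tau) => //.
    by move=> s /tauB[/BV].
  exact: (@smooth_on_line _ _ _ V I f x0 u oI (fun t It => It.1) sf).
exists B, J, sigma, u; split.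
- by split=> // x /BV /V0V.
- split=> //; first by apply: smooth_on_sub ssig => x /BV /V0V.
  by move=> x Bx; exists u; exact: DB.
- by move=> x Bx; split; [exact: DB|apply/eu/BV].
- move=> l f sf kerf; exists (fun s => f (x0 + tau s *: u)); split.
    exact: smth.
  move=> x Bx; apply/rowP => i.
  apply: (facR (fun x => f x 0 i)) => //; first exact: smooth_coord.
  move=> y w Vy ew.
  have [_ ->] := coord_diff i (smooth_differentiable sf Vy).
  by rewrite kerf // mxE.
- move=> f sf kerf; exists (fun s => f (x0 + tau s *: u)); split.
    exact: smth.
  exact: facR.
Qed.

End Foliation.

(** * The four types of hypersurfaces *)

Section Cases.
Context {R : realType} {n : nat}.
Implicit Types (V B : set 'rV[R]_n) (phi nu : 'rV[R]_n -> 'rV[R]_n.+1).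
Implicit Types (al be lam : 'rV[R]_n -> R) (eta : 'rV[R]_n -> 'rV[R]_n).

(** This quantity is the square of the tangential part of X. *)
Lemma tangent_norm_gt0 V phi nu lam y X w : conformal_chart V phi nu lam -> V y ->
  mink X ('D_w phi y) != 0 -> 0 < mink X X + mink X (nu y) ^+ 2.
Proof.
move=> cc Vy Xw; have l0 := cc_pos cc Vy.
have E := chart_parseval cc X X Vy; rewrite E expr2 subrK.
apply: divr_gt0 => //.
have sq i : 0 <= mink X ('D_(bvec i) phi y) * mink X ('D_(bvec i) phi y).
  by rewrite -expr2 sqr_ge0.
rewrite lt_def sumr_ge0 // andbT; apply: contra Xw => /eqP S0.
have dphi := smooth_differentiable (cc_phi cc) Vy.
rewrite (derive_dir_basis w dphi) mink_sumr big1 // => i _.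
apply: etrans (minkZr _ _ _) _.
have /eqP : mink X ('D_(bvec i) phi y) * mink X ('D_(bvec i) phi y) = 0.
  exact: (psumr_eq0P (fun i _ => sq i) S0).
by rewrite mulf_eq0 orbb => /eqP ->; rewrite mulr0.
Qed.

(** The normal is constant, hence so is its product with phi. *)
Lemma case_plane V phi nu lam al be eta x : conformal_chart V phi nu lam -> V x ->
  second_form_decomposition V phi nu al be eta ->
  zero_on V al -> zero_on V be ->
  exists B, [/\ open B, B x, B `<=` V & one_of_four_types B phi nu al be].
Proof.
move=> cc Vx dec a0 b0; have oV := cc_open cc.
have : nbhs x V by exact: open_nbhs_nbhs.
move=> /nbhs_ballP[r /= r0 rV].
have DN y v : V y -> 'D_v nu y = 0.
  move=> Vy; apply: etrans (scale0r ('D_v phi y)).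
  apply: (weingarten_kernel (be := 0) (eta := 0) cc Vy).
  - by move=> u w; have [_ ->] := dec _ Vy; rewrite a0 // b0 // !mul0r.
  - exact: dot0l.
have nuc y : ball x r y -> nu y = nu x.
  apply: ball_const_row.
    by move=> z /rV Vz; exact: smooth_differentiable (cc_nu cc) Vz.
  by move=> z v /rV; exact: DN.
exists (ball x r); split=> //; [exact: ball_open|exact: ballxx|].
constructor 1; split; last 2 first.
- by move=> y /rV; exact: a0.
- by move=> y /rV; exact: b0.
exists (plane (nu x) (mink (phi x) (nu x))).
  by exists (nu x), (mink (phi x) (nu x)); rewrite (cc_unit cc) // ltrN10.
move=> _ [y xy <-]; rewrite /plane /=.
have Vy := rV _ xy; rewrite -[in LHS](nuc _ xy).
pose f z := mink (phi z) (nu z).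
have df z : V z -> differentiable f z /\ forall v, 'D_v f z =
    mink ('D_v phi z) (nu z) + mink (phi z) ('D_v nu z).
  move=> Vz; apply: mink_diff.
    exact: smooth_differentiable (cc_phi cc) Vz.
  exact: smooth_differentiable (cc_nu cc) Vz.
change (f y = f x); apply: (@ball_const _ _ f x y r) => //.
  by move=> z /rV/df[].
move=> z v /rV Vz; have [_ ->] := df _ Vz.
have E := DN z v Vz; rewrite E mink0r addr0 minkC; exact: (cc_normal cc).
Qed.

(** As h = alpha g, the Codazzi equation applies with eta = 0: alpha is constant.
    Then D nu = alpha D phi makes phi - nu / alpha constant. *)
Lemma case_sphere V phi nu lam al be eta x : (2 < n)%N ->
  conformal_chart V phi nu lam -> V x -> smooth_on V al ->
  second_form_decomposition V phi nu al be eta ->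
  nonzero_on V al -> zero_on V be ->
  exists B, [/\ open B, B x, B `<=` V & one_of_four_types B phi nu al be].
Proof.
move=> n2 cc Vx sal dec a0 b0; have oV := cc_open cc.
have : nbhs x V by exact: open_nbhs_nbhs.
move=> /nbhs_ballP[r /= r0 rV].
have H y : V y -> forall v w, second_form phi nu y v w =
    al y * metric phi y v w + 0 * (dot 0 v * dot 0 w).
  by move=> Vy v w; have [_ ->] := dec _ Vy; rewrite b0 // !mul0r.
have Da y v : V y -> 'D_v al y = 0.
  move=> Vy; apply: (codazzi (be := fun=> 0) (eta := fun=> 0) n2 cc) => //.
  - exact: smooth_on_cst.
  - exact: smooth_on_cst.
  - exact: dot0l.
have DN y v : V y -> 'D_v nu y = al y *: 'D_v phi y.
  by move=> Vy; exact: weingarten_kernel cc Vy (H _ Vy) (dot0l _).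
have alc y : ball x r y -> al y = al x.
  apply: ball_const.
    by move=> z /rV Vz; exact: smooth_differentiable sal Vz.
  by move=> z v /rV; exact: Da.
have ax0 := a0 _ Vx.
pose z y := phi y - (al x)^-1 *: nu y.
have zc y : ball x r y -> z y = z x.
  have dz t : V t -> differentiable z t /\ forall v, 'D_v z t =
      'D_v phi t - (al x)^-1 *: 'D_v nu t.
    move=> Vt; have d1 := smooth_differentiable (cc_phi cc) Vt.
    have d2 := smooth_differentiable (cc_nu cc) Vt.
    have d3 := differentiableZ (al x)^-1 d2.
    split; first exact: (differentiableB d1 d3).
    move=> v; apply: etrans (deriveB (diff_derivable d1) (diff_derivable d3)) _.
    by congr (_ - _); exact: deriveZ (diff_derivable d2).
  apply: ball_const_row; first by move=> t /rV/dz[].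
  move=> t v xt; have [_ ->] := dz _ (rV _ xt).
  have E := DN t v (rV _ xt).
  by rewrite E (alc _ xt) scalerA mulVf // scale1r subrr.
exists (ball x r); split=> //; [exact: ball_open|exact: ballxx|].
constructor 2; split; last 2 first.
- by move=> y /rV; exact: a0.
- by move=> y /rV; exact: b0.
exists (hyperquadric (z x) `|(al x)^-1|).
  by exists (z x), `|(al x)^-1|; rewrite normr_gt0 invr_eq0.
move=> _ [y xy <-]; rewrite /hyperquadric /= -(zc _ xy) /z opprB addrC subrK.
rewrite minkZl minkZr (cc_unit cc (rV _ xy)) -normrX ger0_norm ?sqr_ge0 //; ring.
Qed.

(** D nu vanishes on the kernel of eta, so nu = a o sigma and
    (phi, nu) = b o sigma.  Differentiating (phi, nu) = b in a direction
    transversal to the leaves gives the second equation (phi, a') = b' of the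
    generator; a' is a nonzero spacelike vector orthogonal to nu. *)
Lemma case_developable V phi nu lam al be eta x :
  conformal_chart V phi nu lam -> V x ->
  second_form_decomposition V phi nu al be eta ->
  zero_on V al -> nonzero_on V be ->
  exists B, [/\ open B, B x, B `<=` V & one_of_four_types B phi nu al be].
Proof.
move=> cc Vx dec a0 b0; have oV := cc_open cc.
have H y : V y -> forall v w, second_form phi nu y v w =
    al y * metric phi y v w + be y * (dot (eta y) v * dot (eta y) w).
  by move=> Vy; have [_] := dec _ Vy.
have kerN y w : V y -> dot (eta y) w = 0 -> 'D_w nu y = 0.
  move=> Vy ew; rewrite (weingarten_kernel cc Vy (H _ Vy) ew) a0 //; exact: scale0r.
have [xi xiN] : exists xi, 'D_xi nu x != 0.
  have [[xi [xi1 xiE]] _] := dec _ Vx; exists xi; apply/eqP => N0.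
  have := weingarten cc xi xi Vx; rewrite N0 mink0l H // a0 // mul0r add0r.
  rewrite xiE xi1 !mulr1 => /esym/eqP; apply/negP; exact: b0.
have snu := cc_nu cc; have sphi := cc_phi cc.
have [B [J [sigma [u [[oB Bx BV] fol Du facV facR]]]]] :=
  foliation oV Vx snu kerN xiN.
have [[oJ _] ssig sB _] := fol.
have [a [sa aE]] := facV _ nu snu kerN.
pose f y := mink (phi y) (nu y).
have Df y w : V y -> 'D_w f y = mink ('D_w phi y) (nu y) + mink (phi y) ('D_w nu y).
  move=> Vy; have [_ -> //] := mink_diff (smooth_differentiable sphi Vy)
    (smooth_differentiable snu Vy).
have sf : smooth_on V f by exact: smooth_mink.
have [b [sb bE]] : exists a, smooth_on J a /\ forall x, B x -> f x = a (sigma x).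
  apply: facR => // y w Vy ew; rewrite Df // (kerN y w Vy ew) mink0r addr0 minkC.
  exact: (cc_normal cc).
have Js y : B y -> J (sigma y) by move=> By; rewrite -sB; exists y.
have dsig y : B y -> differentiable sigma y by exact: smooth_differentiable.
have DN y : B y -> 'D_u nu y = 'D_u sigma y *: 'D_1 a (sigma y).
  move=> By; exact: (factor_derive u oB By aE (dsig _ By)
    (smooth_differentiable sa (Js _ By))).
have Db y : B y -> 'D_u f y = 'D_u sigma y * 'D_1 b (sigma y).
  move=> By; exact: (factor_derive u oB By bE (dsig _ By)
    (smooth_differentiable sb (Js _ By))).
have XN y : B y -> mink (nu y) ('D_1 a (sigma y)) = 0.
  move=> By; have [s0 _] := Du _ By.
  have := weingarten_normal cc u (BV _ By).
  rewrite (DN _ By) minkZl => /eqP; rewrite mulf_eq0 (negbTE s0) /= => /eqP.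
  by rewrite minkC.
have X0 y : B y -> 'D_1 a (sigma y) != 0.
  move=> By; have Vy := BV _ By; have [_ eu] := Du _ By.
  apply/eqP => X0; have [[xi' [xi1 xiE]] _] := dec _ Vy.
  have := weingarten cc u xi' Vy; rewrite (DN _ By) X0 scaler0 mink0l.
  rewrite H // a0 // mul0r add0r (xiE xi') xi1 mulr1 => /esym/eqP.
  by rewrite mulf_eq0 (negbTE eu) orbF; apply/negP; exact: b0.
exists B; split=> //; constructor 3; split; last 2 first.
- by move=> y /BV; exact: a0.
- by move=> y /BV; exact: b0.
exists J, sigma, a, ('D_1 a), b, ('D_1 b),
  (fun s => plane (a s) (b s) `&` plane ('D_1 a s) ('D_1 b s)).
split=> //.
- by split=> //; exact: smooth_derive.
- move=> s; rewrite -sB => -[y By <-]; split=> //; apply: row_free_pair => p q E.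
  have : mink (nu y) (p *: a (sigma y) + q *: 'D_1 a (sigma y)) = 0.
    by rewrite E mink0r.
  rewrite minkDr !minkZr XN // mulr0 addr0 -aE // (cc_unit cc (BV _ By)).
  rewrite mulrN1 => /eqP; rewrite oppr_eq0 => /eqP p0; split=> //.
  move/eqP: E; rewrite p0 scale0r add0r scaler_eq0 (negbTE (X0 _ By)) orbF.
  by move=> /eqP.
- move=> y By; have Vy := BV _ By; split; rewrite /plane /=.
    by rewrite -aE // -bE.
  have [s0 _] := Du _ By; apply: (mulfI s0); rewrite -Db // Df //.
  have E1 : mink ('D_u phi y) (nu y) = 0 by rewrite minkC (cc_normal cc).
  by rewrite E1 add0r DN // minkZr.
- by move=> y z By Bz E; rewrite !aE // E.
Qed.

Lemma halve_eq (a b : R) : - a + - a = - b -> a = b / 2.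
Proof. by move=> E; lra. Qed.

(** The two equations are the products of a vanishing combination p W + q Y with W
    and with Y, where (W, W) = - k^2, (W, Y) = k N and (Y, Y) = X.  The
    determinant of this system is - k^2 (X + N^2). *)
Lemma timelike_pair_free (p q k N X : R) : k != 0 -> 0 < X + N ^+ 2 ->
  p * - (k * k) + q * (k * N) = 0 -> p * (k * N) + q * X = 0 -> p = 0 /\ q = 0.
Proof.
move=> k0 S0 E1 E2.
have pk : p * k = q * N.
  apply: (mulIf k0); apply/eqP; rewrite -subr_eq0 -[X in _ == X]oppr0 -E1.
  by apply/eqP; ring.
have q0 : q = 0.
  have /eqP : q * (X + N ^+ 2) = 0.
    by rewrite -E2 mulrA pk; ring.
  by rewrite mulf_eq0 (gt_eqF S0) orbF => /eqP.
split=> //; move/eqP: pk; rewrite q0 mul0r mulf_eq0 (negbTE k0) orbF.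
by move=> /eqP.
Qed.

(** The center F = phi - nu / alpha is constant along the leaves of the kernel of
    eta, and so is alpha: F = z o sigma and 1 / alpha^2 = rho o sigma.
    Differentiating (phi - z, phi - z) = - rho in a direction transversal to the
    leaves gives the hyperplane (phi - z, z') = rho' / 2 that cuts the generator
    out of the hypersphere with center z.  Since beta has no zero, z' is not a
    multiple of nu; therefore no point of the generator has a normal
    proportional to z'. *)
Lemma case_canal V phi nu lam al be eta x : (2 < n)%N ->
  conformal_chart V phi nu lam -> V x ->
  smooth_on V al -> smooth_on V be -> smooth_on V eta ->
  second_form_decomposition V phi nu al be eta ->
  nonzero_on V al -> nonzero_on V be ->
  exists B, [/\ open B, B x, B `<=` V & one_of_four_types B phi nu al be].
Proof.
move=> n2 cc Vx sal sbe seta dec a0 b0; have oV := cc_open cc.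
have H y : V y -> forall v w, second_form phi nu y v w =
    al y * metric phi y v w + be y * (dot (eta y) v * dot (eta y) w).
  by move=> Vy; have [_] := dec _ Vy.
have kerA y w : V y -> dot (eta y) w = 0 -> 'D_w al y = 0.
  exact: (codazzi n2 cc sal sbe seta H).
have snu := cc_nu cc; have sphi := cc_phi cc.
pose k y := (al y)^-1.
have sk : smooth_on V k by exact: smooth_onV.
have Dk y w : V y -> 'D_w al y = 0 -> 'D_w k y = 0.
  move=> Vy Dw; have da := smooth_differentiable sal Vy.
  apply: etrans (deriveV (a0 _ Vy) (diff_derivable da)) _.
  by rewrite Dw scaler0.
(* The center of the hypersphere tangent to M along a leaf. *)
pose F y := phi y - k y *: nu y.
have sF : smooth_on V F by apply: smooth_onB => //; exact: smooth_on_scale.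
have DF y w : V y -> 'D_w F y = 'D_w phi y - ('D_w k y *: nu y + k y *: 'D_w nu y).
  move=> Vy; have d1 := smooth_differentiable sphi Vy.
  have [d2 D2] := scale_fun_diff (smooth_differentiable sk Vy)
    (smooth_differentiable snu Vy).
  apply: etrans (deriveB (diff_derivable d1) (diff_derivable d2)) _.
  by rewrite D2.
have kerF y w : V y -> dot (eta y) w = 0 -> 'D_w F y = 0.
  move=> Vy ew; rewrite DF // (Dk _ _ Vy (kerA _ _ Vy ew)) scale0r add0r.
  rewrite (weingarten_kernel cc Vy (H _ Vy) ew) scalerA mulVf ?a0 //.
  by rewrite scale1r subrr.
have FT y v w : V y -> mink ('D_v F y) ('D_w phi y) =
    - (k y * be y * (dot (eta y) v * dot (eta y) w)).
  move=> Vy; rewrite DF // minkDl minkNl minkDl !minkZl (cc_normal cc) //.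
  rewrite (weingarten cc) // H // -/(metric phi y v w) /k.
  by field; exact: a0.
have [xi xiF] : exists xi, 'D_xi F x != 0.
  have [[xi [xi1 xiE]] _] := dec _ Vx; exists xi; apply/eqP => N0.
  have := FT x xi xi Vx; rewrite N0 mink0l (xiE xi) xi1 !mulr1 => /esym/eqP.
  by rewrite oppr_eq0 mulf_eq0 invr_eq0 (negbTE (a0 _ Vx)) (negbTE (b0 _ Vx)).
have [B [J [sigma [u [[oB Bx BV] fol Du facV facR]]]]] :=
  foliation oV Vx sF kerF xiF.
have [[oJ _] ssig sB _] := fol.
have [z [sz zE]] := facV _ F sF kerF.
have skk : smooth_on V (fun y => k y * k y) by exact: smooth_onM.
have [rho [srho rhoE]] : exists a, smooth_on J a /\
    forall x, B x -> k x * k x = a (sigma x).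
  apply: facR => // y w Vy ew.
  have dk := smooth_differentiable sk Vy; have [_ ->] := mul_fun_diff dk dk.
  by rewrite (Dk _ _ Vy (kerA _ _ Vy ew)) mul0r mulr0 addr0.
have Js y : B y -> J (sigma y) by move=> By; rewrite -sB; exists y.
have rho0 s : J s -> 0 < rho s.
  rewrite -sB => -[y By <-]; rewrite -rhoE // -expr2 exprn_even_gt0 //=.
  by rewrite invr_eq0 a0 //; exact: BV.
have dsig y : B y -> differentiable sigma y by exact: smooth_differentiable.
have DFs y : B y -> 'D_u F y = 'D_u sigma y *: 'D_1 z (sigma y).
  move=> By; exact: (factor_derive u oB By zE (dsig _ By)
    (smooth_differentiable sz (Js _ By))).
have Drho y : B y -> 'D_u (fun y => k y * k y) y = 'D_u sigma y * 'D_1 rho (sigma y).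
  move=> By; exact: (factor_derive u oB By rhoE (dsig _ By)
    (smooth_differentiable srho (Js _ By))).
have phiz y : B y -> phi y - z (sigma y) = k y *: nu y.
  by move=> By; rewrite -zE // /F opprB addrC subrK.
have WX y : B y -> mink (phi y - z (sigma y)) ('D_1 z (sigma y)) =
    'D_1 rho (sigma y) / 2.
  move=> By; have Vy := BV _ By; have [s0 _] := Du _ By.
  pose W t := k t *: nu t.
  have sW : smooth_on V W by exact: smooth_on_scale.
  have WW t : V t -> mink (W t) (W t) = - (k t * k t).
    by move=> Vt; rewrite /W minkZl minkZr (cc_unit cc) //; ring.
  have [_ DW] := scale_fun_diff (smooth_differentiable sk Vy)
    (smooth_differentiable snu Vy).
  have DWE : 'D_u W y = 'D_u phi y - 'D_u F y.
    by apply: etrans (DW u) _; rewrite DF // opprB [RHS]addrC subrK.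
  have E1 := mink_product_rule cc u sW sW Vy WW.
  have E2 : 'D_u (fun t => - (k t * k t)) y = - 'D_u (fun t => k t * k t) y.
    exact: deriveN (diff_derivable (smooth_differentiable skk Vy)).
  have E3 : mink (W y) ('D_u phi y) = 0.
    by apply: etrans (minkZl _ _ _) _; rewrite (cc_normal cc) // mulr0.
  rewrite phiz // -/(W y); apply: (mulfI s0).
  rewrite -minkZr -DFs // mulrA -Drho //.
  have E4 : mink (W y) ('D_u W y) = - mink (W y) ('D_u F y).
    by rewrite DWE minkDr minkNr E3 add0r.
  rewrite [mink ('D_u W y) _]minkC E4 E2 in E1.
  apply: halve_eq E1.
have XT y : B y -> exists w, mink ('D_1 z (sigma y)) ('D_w phi y) != 0.
  move=> By; have Vy := BV _ By; have [s0 eu] := Du _ By.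
  have [[xi' [xi1 xiE]] _] := dec _ Vy; exists xi'; apply/eqP => E0.
  have := FT y u xi' Vy; rewrite DFs // minkZl E0 mulr0 (xiE xi') xi1 mulr1.
  move=> /esym/eqP; rewrite oppr_eq0 !mulf_eq0 (negbTE eu) (negbTE (b0 _ Vy)).
  by rewrite invr_eq0 (negbTE (a0 _ Vy)).
exists B; split=> //; constructor 4; split; last 2 first.
- by move=> y /BV; exact: a0.
- by move=> y /BV; exact: b0.
pose b s := mink (z s) ('D_1 z s) + 'D_1 rho s / 2.
pose r s := Num.sqrt (rho s).
have sb : smooth_on J b.
  apply: smooth_onD => //.
    by apply: smooth_mink => //; exact: smooth_derive.
  by apply: smooth_onM => //; [exact: smooth_derive|exact: smooth_on_cst].
have inS y : B y -> (hyperquadric (z (sigma y)) (r (sigma y)) `&`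
    plane ('D_1 z (sigma y)) (b (sigma y))) (phi y).
  move=> By; have Vy := BV _ By; split; rewrite /hyperquadric /plane /=.
    rewrite phiz // minkZl minkZr (cc_unit cc) // sqr_sqrtr; last exact/ltW/rho0/Js.
    by rewrite -rhoE //; ring.
  by rewrite /b -WX // -minkDl addrC subrK.
exists J, sigma, z, ('D_1 z), r, b,
  (fun s => hyperquadric (z s) (r s) `&` plane ('D_1 z s) (b s)), z.
split=> //.
- by split=> //; [exact: smooth_on_sqrt|exact: smooth_derive].
- move=> s; rewrite -sB => -[y By <-]; have Vy := BV _ By.
  have Jy := Js _ By; have r0 := rho0 _ Jy.
  have [w Xw] := XT _ By.
  have S0 := tangent_norm_gt0 cc Vy Xw.
  split=> //.
  + by rewrite sqrtr_gt0.
  + by apply: contraNneq Xw => ->; rewrite mink0l.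
  + by exists (phi y); exact: inS.
  move=> Z [ZQ ZP]; rewrite /hyperquadric /plane /= in ZQ ZP.
  rewrite sqr_sqrtr in ZQ; last exact: ltW.
  have ZX : mink (Z - z (sigma y)) ('D_1 z (sigma y)) =
      k y * mink ('D_1 z (sigma y)) (nu y).
    rewrite minkDl minkNl ZP /b addrC addKr -WX // phiz //.
    by rewrite minkZl minkC.
  rewrite -rhoE // in ZQ r0.
  apply: row_free_pair => p q E.
  have E1 : mink (Z - z (sigma y)) (p *: (Z - z (sigma y)) + q *: 'D_1 z (sigma y)) = 0.
    by rewrite E mink0r.
  have E2 : mink ('D_1 z (sigma y)) (p *: (Z - z (sigma y)) + q *: 'D_1 z (sigma y)) = 0.
    by rewrite E mink0r.
  move: E1 E2; rewrite !minkDr !minkZr ZQ [mink ('D_1 z _) (Z - _)]minkC ZX.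
  apply: timelike_pair_free S0; rewrite invr_eq0; exact: a0.
- by move=> y By; exists (- k y); rewrite -zE // scaleNr.
Qed.

End Cases.

Theorem theorem5p8 (R : realType) (n : nat) (n_ge4 : (4 <= n)%N)
    (M : set 'rV[R]_n.+1)
    (M_hypersurface : hypersurface M)
    (M_spacelike : spacelike M)
    (M_conformally_flat : conformally_flat M) :
  forall p : 'rV[R]_n.+1, M p ->
  exists (U : set 'rV[R]_n) (phi nu : 'rV[R]_n -> 'rV[R]_n.+1)
      (alpha beta : 'rV[R]_n -> R) (eta : 'rV[R]_n -> 'rV[R]_n),
    [/\ local_parametrization M U phi /\ (phi @` U) p,
        unit_normal U phi nu,
        second_form_decomposition U phi nu alpha beta eta,
        U `<=` closure (generic U alpha beta)
      & forall x : 'rV[R]_n, generic U alpha beta x ->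
        exists (V : set 'rV[R]_n) (eta' : 'rV[R]_n -> 'rV[R]_n),
          [/\ [/\ open V, V x & V `<=` U],
              [/\ smooth_on V alpha, smooth_on V beta & smooth_on V eta'],
              second_form_decomposition V phi nu alpha beta eta'
            & one_of_four_types V phi nu alpha beta]].
Proof.
move=> p Mp; have [U [phi [lam [loc Up conf]]]] := M_conformally_flat p Mp.
have [[oU sphi] _ _ _ _] := loc.
have [nu cc] := exists_normal (Ordinal (leq_trans (ltn0Sn 3) n_ge4)) oU sphi conf.
have n2 : (2 < n)%N by exact: leq_trans n_ge4.
pose alpha := alpha_of phi nu lam; pose beta := beta_of phi nu lam.
have [eta dec] := exists_eta n_ge4 cc.
exists U, phi, nu, alpha, beta, eta; split=> //.
- split; first exact: (cc_nu cc).
  by move=> x Ux; split; [exact: (cc_unit cc)|exact: (cc_normal cc)].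
- exact: (generic_dense n_ge4 cc).
move=> x [V [oV Vx VU aV bV]].
have [V1 [eta1 [oV1 V1x V1V seta1 dec1]]] := exists_smooth_eta n_ge4 cc oV VU Vx bV.
have V1U : V1 `<=` U by move=> y /V1V/VU.
have cc1 := conformal_chart_sub oV1 V1U cc.
have [sa sb] : smooth_on V1 alpha /\ smooth_on V1 beta.
  case: bV => b0.
    by apply: (smooth_coefs_zero cc oV1 V1U) => y /V1V; exact: b0.
  by apply: (smooth_coefs_nonzero n_ge4 cc oV1 V1U) => y /V1V; exact: b0.
suff [B [oB Bx BV1 B4]] : exists B, [/\ open B, B x, B `<=` V1 &
    one_of_four_types B phi nu alpha beta].
  exists B, eta1; split=> //.
  - by split=> // y /BV1/V1U.
  - by split; apply: smooth_on_sub BV1 _.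
  - by move=> y /BV1; exact: dec1.
case: aV bV => a0 [] b0.
- apply: (case_plane cc1 V1x dec1) => y /V1V; [exact: a0|exact: b0].
- apply: (case_developable cc1 V1x dec1) => y /V1V; [exact: a0|exact: b0].
- apply: (case_sphere n2 cc1 V1x sa dec1) => y /V1V; [exact: a0|exact: b0].
- apply: (case_canal n2 cc1 V1x sa sb seta1 dec1) => y /V1V; [exact: a0|exact: b0].
Qed.
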